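(* Let $\mathcal E:0\to V\to\widehat{\mathfrak p}\xrightarrow{p}\mathfrak p\to0$ be an abelian extension of crossed modules over Leibniz algebras, with $V=(V_1,V_0,\varphi)$, $\mathfrak p=(\mathfrak p_1,\mathfrak p_0,f)$, section $\sigma$, induced representation $\rho$ of $\mathfrak p$ on $V$ and associated 2-cocycle $(\theta,\omega,\mu,\nu)$. Then there is an exact sequence of (additive) groups $$0\to Z^1(\mathfrak p,V)\xrightarrow{\ i\ }\mathrm{Der}_V(\widehat{\mathfrak p})\xrightarrow{\ \Phi\ }D_\rho(\mathfrak p,V)\xrightarrow{\ \varpi_{\mathcal E}\ }H^2(\mathfrak p,V),$$ where $i(\lambda)=D_\lambda$, $\Phi(D)=(D|_V,\overline D)$ and $\varpi_{\mathcal E}$ is the Wells map.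
   Context: All vector spaces are over a fixed field. A Leibniz algebra is a vector space with a bilinear bracket satisfying $[x,[y,z]]=[[x,y],z]+[y,[x,z]]$. A representation of a Leibniz algebra $\mathfrak p_0$ is a vector space $M$ with bilinear maps $\mathfrak p_0\otimes M\to M$, $M\otimes\mathfrak p_0\to M$ (both written $\cdot$) with $[x,y]\cdot m=x\cdot(y\cdot m)-y\cdot(x\cdot m)$; $m\cdot[x,y]=(m\cdot x)\cdot y+x\cdot(m\cdot y)$; $m\cdot[x,y]=x\cdot(m\cdot y)-(x\cdot m)\cdot y$. A crossed module over Leibniz algebra is a triple $(\mathfrak p_1,\mathfrak p_0,f)$ with $\mathfrak p_0$ a Leibniz algebra, $\mathfrak p_1$ a representation of $\mathfrak p_0$, and $f:\mathfrak p_1\to\mathfrak p_0$ linear with $f(x\cdot a)=[x,f(a)]$, $f(a\cdot x)=[f(a),x]$ and $f(a)\cdot b=a\cdot f(b)$. Write $[x,a]=x\cdot a$, $[a,x]=a\cdot x$. A homomorphism $F=(F_0,F_1)$ consists of linear maps $F_i:\mathfrak p_i\to\mathfrak p_i'$ with $F_0f=f'F_1$, $F_0[x,y]=[F_0x,F_0y]'$, $F_1[x,a]=[F_0x,F_1a]'$, $F_1[a,x]=[F_1a,F_0x]'$. A derivation $D=(D_0,D_1)$ of $(\mathfrak p_1,\mathfrak p_0,f)$ consists of linear maps $D_i:\mathfrak p_i\to\mathfrak p_i$ with $D_0f=fD_1$, $D_0[x,y]=[D_0x,y]+[x,D_0y]$, $D_1[x,a]=[D_0x,a]+[x,D_1a]$,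 $D_1[a,x]=[D_1a,x]+[a,D_0x]$. An extension of $(\mathfrak p_1,\mathfrak p_0,f)$ by $(V_1,V_0,\varphi)$ is a sequence $0\to V\to\widehat{\mathfrak p}\xrightarrow{p}\mathfrak p\to0$ of crossed modules and homomorphisms, short exact in each degree ($V\to\widehat{\mathfrak p}$ regarded as an inclusion), $\widehat{\mathfrak p}=(\widehat{\mathfrak p}_1,\widehat{\mathfrak p}_0,\widehat f)$. It is abelian if the bracket on $V_0$ is zero and the actions of $V_0$ on $V_1$ are zero. A section is a pair of linear maps $\sigma_i:\mathfrak p_i\to\widehat{\mathfrak p}_i$ with $p_i\sigma_i=\mathrm{id}$. For $x,y\in\mathfrak p_0$, $a\in\mathfrak p_1$, $w\in V_0$, $m\in V_1$, the representation $\rho=(l_0,r_0,l_1,r_1)$ is: $l_0(x)(w+m)=[\sigma_0x,w+m]$, $r_0(x)(w+m)=[w+m,\sigma_0x]$, $l_1(a)(w)=[\sigma_1a,w]$, $r_1(a)(w)=[w,\sigma_1a]$; the associated 2-cocycle is $\theta(a)=\widehat f\sigma_1(a)-\sigma_0(f(a))$, $\omega(x,y)=[\sigma_0x,\sigma_0y]-\sigma_0[x,y]$, $\mu(x,a)=[\sigma_0x,\sigma_1a]-\sigma_1[x,a]$, $\nu(a,x)=[\sigma_1a,\sigma_0x]-\sigma_1[a,x]$. Cohomology. For $\lambda=(\lambda_0,\lambda_1)\in\mathrm{Hom}(\mathfrak p_0,V_0)\oplus\mathrm{Hom}(\mathfrak p_1,V_1)$ let $\partial\lambda=(\theta,\omega,\mu,\nu)$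 with $\theta(a)=\varphi\lambda_1(a)-\lambda_0f(a)$; $\omega(x,y)=l_0(x)\lambda_0(y)+r_0(y)\lambda_0(x)-\lambda_0[x,y]$; $\mu(x,a)=l_0(x)\lambda_1(a)+r_1(a)\lambda_0(x)-\lambda_1[x,a]$; $\nu(a,x)=l_1(a)\lambda_0(x)+r_0(x)\lambda_1(a)-\lambda_1[a,x]$. $Z^1(\mathfrak p,V)$ is the additive group of $\lambda$ with $\partial\lambda=0$. $Z^2(\mathfrak p,V)$ is the space of tuples $(\theta,\omega,\mu,\nu)$, $\theta\in\mathrm{Hom}(\mathfrak p_1,V_0)$, $\omega\in\mathrm{Hom}(\mathfrak p_0^{\otimes2},V_0)$, $\mu\in\mathrm{Hom}(\mathfrak p_0\otimes\mathfrak p_1,V_1)$, $\nu\in\mathrm{Hom}(\mathfrak p_1\otimes\mathfrak p_0,V_1)$, such that $(\mathfrak p_1\oplus V_1,\mathfrak p_0\oplus V_0)$ is a crossed module over Leibniz algebra under $a+m\mapsto f(a)+\theta(a)+\varphi(m)$; $[x+u,y+v]=[x,y]+\omega(x,y)+l_0(x)v+r_0(y)u$; $[x+u,a+m]=[x,a]+\mu(x,a)+l_0(x)m+r_1(a)u$; $[a+m,x+u]=[a,x]+\nu(a,x)+l_1(a)u+r_0(x)m$. $B^2(\mathfrak p,V)$ is the space of all $\partial\lambda$ and $H^2=Z^2/B^2$. $\mathrm{Der}(V)$, $\mathrm{Der}(\mathfrak p)$ are the additive groups of derivations. $\mathrm{Der}_V(\widehat{\mathfrak p})$ is the additive group of derivations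 $D$ of $\widehat{\mathfrak p}$ with $D_0(V_0)\subseteq V_0$, $D_1(V_1)\subseteq V_1$; $D|_V=(D_0|_{V_0},D_1|_{V_1})$, $\overline D=(p_0D_0\sigma_0,p_1D_1\sigma_1)$. $D_\rho(\mathfrak p,V)$ is the subgroup of $(\beta,\alpha)\in\mathrm{Der}(V)\times\mathrm{Der}(\mathfrak p)$ with, for all $x\in\mathfrak p_0$, $a\in\mathfrak p_1$, $v\in V_0$, $m\in V_1$: $\beta_0l_0(x)v=l_0(\alpha_0x)v+l_0(x)\beta_0v$; $\beta_0r_0(x)v=r_0(\alpha_0x)v+r_0(x)\beta_0v$; $\beta_1l_0(x)m=l_0(\alpha_0x)m+l_0(x)\beta_1m$; $\beta_1r_0(x)m=r_0(\alpha_0x)m+r_0(x)\beta_1m$; $\beta_1l_1(a)v=l_1(\alpha_1a)v+l_1(a)\beta_0v$; $\beta_1r_1(a)v=r_1(\alpha_1a)v+r_1(a)\beta_0v$. For $\lambda\in Z^1(\mathfrak p,V)$: $D_{\lambda,0}(\sigma_0x+v)=\lambda_0(x)$, $D_{\lambda,1}(\sigma_1a+m)=\lambda_1(a)$. Wells map: for $(\beta,\alpha)\in D_\rho(\mathfrak p,V)$, $\Psi(\beta,\alpha)(\theta,\omega,\mu,\nu)$ is the 2-cocycle with components $\beta_0\theta(a)-\theta(\alpha_1a)$; $\beta_0\omega(x,y)-\omega(\alpha_0x,y)-\omega(x,\alpha_0y)$; $\beta_1\mu(x,a)-\mu(\alpha_0x,a)-\mu(x,\alpha_1a)$; $\beta_1\nu(a,x)-\nu(\alpha_1a,x)-\nu(a,\alpha_0x)$;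 and $\varpi_{\mathcal E}(\beta,\alpha)=[\Psi(\beta,\alpha)(\theta,\omega,\mu,\nu)]\in H^2(\mathfrak p,V)$ for the cocycle of $\mathcal E$. *)

(* Defs.v *)
From HB Require Import structures.
From mathcomp Require Import all_boot all_order all_algebra.
From mathcomp Require Import boolp classical_sets functions.

Set Implicit Arguments.
Unset Strict Implicit.
Unset Printing Implicit Defensive.
Import GRing.Theory.
Local Open Scope ring_scope.
Local Open Scope quotient_scope.

Record subgroup (T : zmodType) := Subgroup {
  sg_mem :> T -> Prop;
  sg_mem0 : sg_mem 0;
  sg_memB : forall x y, sg_mem x -> sg_mem y -> sg_mem (x - y) }.

Section SubgroupType.
Variables (T : zmodType) (G : subgroup T).

Definition sg_pred : {pred T} := fun x => `[< G x >].

Lemma sg_pred_zmod_closed : zmod_closed sg_pred.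
Proof.
split; first by apply/asboolP; apply: sg_mem0.
by move=> x y /asboolP Gx /asboolP Gy; apply/asboolP; apply: sg_memB.
Qed.

HB.instance Definition _ := GRing.isZmodClosed.Build T sg_pred
  sg_pred_zmod_closed.

Record sg_type := SgType { sg_val : T; sg_valP : sg_val \in sg_pred }.

HB.instance Definition _ := [isSub for sg_val].
HB.instance Definition _ := [Choice of sg_type by <:].
HB.instance Definition _ := [SubChoice_isSubZmodule of sg_type by <:].

Lemma sg_val_is_zmod_morphism : zmod_morphism sg_val.
Proof. by []. Qed.
HB.instance Definition _ := GRing.isZmodMorphism.Build sg_type T sg_val
  sg_val_is_zmod_morphism.

Definition sg_quot : Type := Quotient.quot sg_pred.
HB.instance Definition _ := GRing.Zmodule.on sg_quot.
Definition sg_pi (x : T) : sg_quot := \pi_(Quotient.quot sg_pred) x.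

Lemma sg_pi_is_zmod_morphism : zmod_morphism sg_pi.
Proof. by move=> x y; rewrite /sg_pi [LHS]raddfB. Qed.
HB.instance Definition _ := GRing.isZmodMorphism.Build T sg_quot sg_pi
  sg_pi_is_zmod_morphism.

Lemma sg_pi_eq0 x : sg_pi x = 0 <-> G x.
Proof.
rewrite -(raddf0 sg_pi) /sg_pi; split=> [/eqP|Gx].
  by rewrite -Quotient.idealrBE subr0 => /asboolP.
by apply/eqP; rewrite -Quotient.idealrBE subr0; apply/asboolP.
Qed.

Lemma sg_typeP (x : sg_type) : G (sg_val x).
Proof. by case: x => x /= /asboolP. Qed.

Definition sg_elt (x : T) (Gx : G x) : sg_type := SgType (asboolT Gx).

End SubgroupType.

Section CrossedModules.
Variable F : fieldType.

Definition is_bilinear (U V W : lmodType F) (b : U -> V -> W) : Prop :=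
  (forall x, linear (b x)) /\ (forall y, linear (b^~ y)).

Definition is_leibniz (U : lmodType F) (br : U -> U -> U) : Prop :=
  is_bilinear br /\
  forall x y z, br x (br y z) = br (br x y) z + br y (br x z).

(* la x m is x . m, written [x, m] in a crossed module; ra m x is m . x,
   written [m, x]. *)
Record is_representation (U M : lmodType F) (br : U -> U -> U)
    (la : U -> M -> M) (ra : M -> U -> M) : Prop := IsRepresentation {
  rep_la_bilin : is_bilinear la;
  rep_ra_bilin : is_bilinear ra;
  rep_la_br : forall x y m, la (br x y) m = la x (la y m) - la y (la x m);
  rep_ra_br : forall x y m, ra m (br x y) = ra (ra m x) y + la x (ra m y);
  rep_la_ra : forall x y m, ra m (br x y) = la x (ra m y) - ra (la x m) y }.

Record is_crossed_module (U1 U0 : lmodType F) (f : U1 -> U0)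
    (br : U0 -> U0 -> U0) (la : U0 -> U1 -> U1) (ra : U1 -> U0 -> U1)
    : Prop := IsCrossedModule {
  icm_leibniz : is_leibniz br;
  icm_rep : is_representation br la ra;
  icm_lin : linear f;
  icm_la : forall x a, f (la x a) = br x (f a);
  icm_ra : forall x a, f (ra a x) = br (f a) x;
  icm_peiffer : forall a b, la (f a) b = ra a (f b) }.

Record crossed_module := CrossedModule {
  cm0 : lmodType F;
  cm1 : lmodType F;
  cmf : cm1 -> cm0;
  cmbr : cm0 -> cm0 -> cm0;
  cmla : cm0 -> cm1 -> cm1;
  cmra : cm1 -> cm0 -> cm1;
  cmP : is_crossed_module cmf cmbr cmla cmra }.

HB.instance Definition _ (C : crossed_module) :=
  GRing.isLinear.Build F (cm1 C) (cm0 C) *:%R (@cmf C) (icm_lin (cmP C)).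

Section BilinearInstance.
Variables (U V W : lmodType F) (b : U -> V -> W) (bP : is_bilinear b).

Lemma is_bilinear_for :
  bilinear_for (GRing.Scale.Law.clone _ _ *:%R _)
               (GRing.Scale.Law.clone _ _ *:%R _) b.
Proof. by case: bP. Qed.

End BilinearInstance.

HB.instance Definition _ (C : crossed_module) :=
  bilinear_isBilinear.Build F (cm0 C) (cm0 C) (cm0 C) _ _ (@cmbr C)
    (is_bilinear_for (icm_leibniz (cmP C)).1).
HB.instance Definition _ (C : crossed_module) :=
  bilinear_isBilinear.Build F (cm0 C) (cm1 C) (cm1 C) _ _ (@cmla C)
    (is_bilinear_for (rep_la_bilin (icm_rep (cmP C)))).
HB.instance Definition _ (C : crossed_module) :=
  bilinear_isBilinear.Build F (cm1 C) (cm0 C) (cm1 C) _ _ (@cmra C)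
    (is_bilinear_for (rep_ra_bilin (icm_rep (cmP C)))).

Record cm_hom (C D : crossed_module) := CmHom {
  hom0 : {linear cm0 C -> cm0 D};
  hom1 : {linear cm1 C -> cm1 D};
  hom_f : forall a, hom0 (cmf a) = cmf (hom1 a);
  hom_br : forall x y, hom0 (cmbr x y) = cmbr (hom0 x) (hom0 y);
  hom_la : forall x a, hom1 (cmla x a) = cmla (hom0 x) (hom1 a);
  hom_ra : forall a x, hom1 (cmra a x) = cmra (hom1 a) (hom0 x) }.

(* Pairs of maps are listed degree 0 first: D = (D_0, D_1). *)
Record is_derivation (C : crossed_module)
    (D : (cm0 C -> cm0 C) * (cm1 C -> cm1 C)) : Prop := IsDerivation {
  der_lin0 : linear D.1;
  der_lin1 : linear D.2;
  der_f : forall a, D.1 (cmf a) = cmf (D.2 a);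
  der_br : forall x y, D.1 (cmbr x y) = cmbr (D.1 x) y + cmbr x (D.1 y);
  der_la : forall x a, D.2 (cmla x a) = cmla (D.1 x) a + cmla x (D.2 a);
  der_ra : forall a x, D.2 (cmra a x) = cmra (D.2 a) x + cmra a (D.1 x) }.

Lemma is_derivation0 (C : crossed_module) : @is_derivation C 0.
Proof.
split.
- by move=> k x y /=; rewrite scaler0 addr0.
- by move=> k x y /=; rewrite scaler0 addr0.
- by move=> a /=; rewrite linear0.
- by move=> x y /=; rewrite linear0l linear0r addr0.
- by move=> x a /=; rewrite linear0l linear0r addr0.
- by move=> a x /=; rewrite linear0l linear0r addr0.
Qed.

Lemma linear_funB (U W : lmodType F) (f g : U -> W) :
  linear f -> linear g -> linear (f - g).
Proof.
move=> lf lg k x y; rewrite /GRing.add /GRing.opp /= lf lg.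
by rewrite scalerBr opprD addrACA.
Qed.

Lemma is_derivationB (C : crossed_module) D D' :
  @is_derivation C D -> @is_derivation C D' -> @is_derivation C (D - D').
Proof.
move=> d d'; have dB0 x : (D - D').1 x = D.1 x - D'.1 x by [].
have dB1 a : (D - D').2 a = D.2 a - D'.2 a by [].
split.
- exact: linear_funB (der_lin0 d) (der_lin0 d').
- exact: linear_funB (der_lin1 d) (der_lin1 d').
- by move=> a; rewrite dB0 dB1 (der_f d) (der_f d') linearB.
- move=> x y; rewrite !dB0 (der_br d) (der_br d').
  by rewrite linearBl linearBr opprD addrACA.
- move=> x a; rewrite !dB0 !dB1 (der_la d) (der_la d').
  by rewrite linearBl linearBr opprD addrACA.
- move=> a x; rewrite !dB0 !dB1 (der_ra d) (der_ra d').
  by rewrite linearBl linearBr opprD addrACA.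
Qed.

Definition der_subgroup (C : crossed_module) :=
  Subgroup (is_derivation0 C) (@is_derivationB C).

Definition Der (C : crossed_module) : zmodType := sg_type (der_subgroup C).

Definition der0 (C : crossed_module) (D : Der C) : cm0 C -> cm0 C :=
  (sg_val D).1.
Definition der1 (C : crossed_module) (D : Der C) : cm1 C -> cm1 C :=
  (sg_val D).2.

Record extension (V P : crossed_module) := Extension {
  ext_tot : crossed_module;
  ext_inc : cm_hom V ext_tot;
  ext_proj : cm_hom ext_tot P;
  ext_inc0_inj : injective (hom0 ext_inc);
  ext_inc1_inj : injective (hom1 ext_inc);
  ext_exact0 : forall y, hom0 ext_proj y = 0 <-> exists v, hom0 ext_inc v = y;
  ext_exact1 : forall b, hom1 ext_proj b = 0 <-> exists m, hom1 ext_inc m = b;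
  ext_proj0_surj : forall x, exists y, hom0 ext_proj y = x;
  ext_proj1_surj : forall a, exists b, hom1 ext_proj b = a }.

Record is_abelian (V : crossed_module) : Prop := IsAbelian {
  abelian_br : forall u v : cm0 V, cmbr u v = 0;
  abelian_la : forall (u : cm0 V) (m : cm1 V), cmla u m = 0;
  abelian_ra : forall (m : cm1 V) (u : cm0 V), cmra m u = 0 }.

Record abelian_extension (V P : crossed_module) := AbelianExtension {
  abext_ext :> extension V P;
  abext_abelian : is_abelian V }.

Record ext_section (V P : crossed_module) (E : extension V P) := ExtSection {
  sec0 : {linear cm0 P -> cm0 (ext_tot E)};
  sec1 : {linear cm1 P -> cm1 (ext_tot E)};
  sec0K : cancel sec0 (hom0 (ext_proj E));
  sec1K : cancel sec1 (hom1 (ext_proj E)) }.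

(* The preimage of y under f; the junk value 0 if there is none.  It is used to
   read an element of the image of V -> E as an element of V. *)
Definition pull (U W : lmodType F) (f : U -> W) (y : W) : U :=
  xget 0 [set u | f u = y].

Lemma pullP (U W : lmodType F) (f : U -> W) (y : W) :
  (exists u, f u = y) -> f (pull f y) = y.
Proof. by move=> fy; rewrite /pull; apply: (xgetPex 0 (P := [set u | f u = y])). Qed.

Section Cohomology.
Variables (V P : crossed_module) (E : abelian_extension V P).
Variable s : ext_section E.

Local Notation hat := (ext_tot E).
Local Notation inc0 := (hom0 (ext_inc E)).
Local Notation inc1 := (hom1 (ext_inc E)).
Local Notation p0 := (hom0 (ext_proj E)).
Local Notation p1 := (hom1 (ext_proj E)).
Local Notation s0 := (sec0 s).
Local Notation s1 := (sec1 s).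

(* l_0 and r_0 act on V_0 + V_1; their two components are l00, l01 and
   r00, r01. *)
Definition l00 (x : cm0 P) (w : cm0 V) : cm0 V :=
  pull inc0 (cmbr (s0 x) (inc0 w)).
Definition l01 (x : cm0 P) (m : cm1 V) : cm1 V :=
  pull inc1 (cmla (s0 x) (inc1 m)).
Definition r00 (x : cm0 P) (w : cm0 V) : cm0 V :=
  pull inc0 (cmbr (inc0 w) (s0 x)).
Definition r01 (x : cm0 P) (m : cm1 V) : cm1 V :=
  pull inc1 (cmra (inc1 m) (s0 x)).
Definition l1 (a : cm1 P) (w : cm0 V) : cm1 V :=
  pull inc1 (cmra (s1 a) (inc0 w)).
Definition r1 (a : cm1 P) (w : cm0 V) : cm1 V :=
  pull inc1 (cmla (inc0 w) (s1 a)).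

Definition cochain1 : zmodType :=
  ((cm0 P -> cm0 V) * (cm1 P -> cm1 V))%type.

Definition cochain2 : zmodType :=
  ((cm1 P -> cm0 V) * (cm0 P -> cm0 P -> cm0 V) *
   (cm0 P -> cm1 P -> cm1 V) * (cm1 P -> cm0 P -> cm1 V))%type.

(* The components (theta, omega, mu, nu) of a 2-cochain. *)
Definition cth (c : cochain2) : cm1 P -> cm0 V := c.1.1.1.
Definition com (c : cochain2) : cm0 P -> cm0 P -> cm0 V := c.1.1.2.
Definition cmu (c : cochain2) : cm0 P -> cm1 P -> cm1 V := c.1.2.
Definition cnu (c : cochain2) : cm1 P -> cm0 P -> cm1 V := c.2.

Definition ext_cocycle : cochain2 :=
  (fun a => pull inc0 (cmf (s1 a) - s0 (cmf a)),
   fun x y => pull inc0 (cmbr (s0 x) (s0 y) - s0 (cmbr x y)),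
   fun x a => pull inc1 (cmla (s0 x) (s1 a) - s1 (cmla x a)),
   fun a x => pull inc1 (cmra (s1 a) (s0 x) - s1 (cmra a x))).

Definition coboundary (h : cochain1) : cochain2 :=
  (fun a => cmf (h.2 a) - h.1 (cmf a),
   fun x y => l00 x (h.1 y) + r00 y (h.1 x) - h.1 (cmbr x y),
   fun x a => l01 x (h.2 a) + r1 a (h.1 x) - h.2 (cmla x a),
   fun a x => l1 a (h.1 x) + r01 x (h.2 a) - h.2 (cmra a x)).

(* The structure on (P_1 + V_1, P_0 + V_0) twisted by c; c is a 2-cocycle when
   this is a crossed module. *)
Definition twist_f (c : cochain2) (am : cm1 P * cm1 V) : cm0 P * cm0 V :=
  (cmf am.1, cth c am.1 + cmf am.2).
Definition twist_br (c : cochain2) (xu yv : cm0 P * cm0 V) : cm0 P * cm0 V :=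
  (cmbr xu.1 yv.1, com c xu.1 yv.1 + l00 xu.1 yv.2 + r00 yv.1 xu.2).
Definition twist_la (c : cochain2) (xu : cm0 P * cm0 V) (am : cm1 P * cm1 V)
    : cm1 P * cm1 V :=
  (cmla xu.1 am.1, cmu c xu.1 am.1 + l01 xu.1 am.2 + r1 am.1 xu.2).
Definition twist_ra (c : cochain2) (am : cm1 P * cm1 V) (xu : cm0 P * cm0 V)
    : cm1 P * cm1 V :=
  (cmra am.1 xu.1, cnu c am.1 xu.1 + l1 am.1 xu.2 + r01 xu.1 am.2).

Record is_cochain1 (h : cochain1) : Prop := IsCochain1 {
  cochain1_lin0 : linear h.1;
  cochain1_lin1 : linear h.2 }.

Record is_cochain2 (c : cochain2) : Prop := IsCochain2 {
  cochain2_th : linear (cth c);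
  cochain2_om : is_bilinear (com c);
  cochain2_mu : is_bilinear (cmu c);
  cochain2_nu : is_bilinear (cnu c) }.

Definition is_cocycle1 (h : cochain1) : Prop := is_cochain1 h /\ coboundary h = 0.

Definition is_cocycle2 (c : cochain2) : Prop :=
  is_cochain2 c /\
  is_crossed_module (twist_f c) (twist_br c) (twist_la c) (twist_ra c).

Lemma proj_inc0 v : p0 (inc0 v) = 0.
Proof. by apply: (@ext_exact0 _ _ E _).2; exists v. Qed.

Lemma proj_inc1 m : p1 (inc1 m) = 0.
Proof. by apply: (@ext_exact1 _ _ E _).2; exists m. Qed.

Lemma pull0P y : p0 y = 0 -> inc0 (pull inc0 y) = y.
Proof. by move=> /(@ext_exact0 _ _ E _).1 /pullP. Qed.

Lemma pull1P b : p1 b = 0 -> inc1 (pull inc1 b) = b.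
Proof. by move=> /(@ext_exact1 _ _ E _).1 /pullP. Qed.

Lemma ext_split0 (y : cm0 hat) : exists v, y = s0 (p0 y) + inc0 v.
Proof.
have /(@ext_exact0 _ _ E _).1 [v vE] : p0 (y - s0 (p0 y)) = 0.
  by rewrite linearB /= sec0K subrr.
by exists v; rewrite vE addrC subrK.
Qed.

Lemma ext_split1 (b : cm1 hat) : exists m, b = s1 (p1 b) + inc1 m.
Proof.
have /(@ext_exact1 _ _ E _).1 [m mE] : p1 (b - s1 (p1 b)) = 0.
  by rewrite linearB /= sec1K subrr.
by exists m; rewrite mE addrC subrK.
Qed.

Lemma br_incr y w : cmbr y (inc0 w) = inc0 (l00 (p0 y) w).
Proof.
rewrite pull0P; last by rewrite hom_br proj_inc0 linear0r.
have [v {1}->] := ext_split0 y.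
by rewrite linearDl /= -(hom_br (ext_inc E)) (abelian_br (abext_abelian E))
  linear0 addr0.
Qed.

Lemma br_incl y w : cmbr (inc0 w) y = inc0 (r00 (p0 y) w).
Proof.
rewrite pull0P; last by rewrite hom_br proj_inc0 linear0l.
have [v {1}->] := ext_split0 y.
by rewrite linearDr /= -(hom_br (ext_inc E)) (abelian_br (abext_abelian E))
  linear0 addr0.
Qed.

Lemma la_incr y m : cmla y (inc1 m) = inc1 (l01 (p0 y) m).
Proof.
rewrite pull1P; last by rewrite hom_la proj_inc1 linear0r.
have [v {1}->] := ext_split0 y.
by rewrite linearDl /= -(hom_la (ext_inc E)) (abelian_la (abext_abelian E))
  linear0 addr0.
Qed.

Lemma la_incl b w : cmla (inc0 w) b = inc1 (r1 (p1 b) w).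
Proof.
rewrite pull1P; last by rewrite hom_la proj_inc0 linear0l.
have [v {1}->] := ext_split1 b.
by rewrite linearDr /= -(hom_la (ext_inc E)) (abelian_la (abext_abelian E))
  linear0 addr0.
Qed.

Lemma ra_incr b w : cmra b (inc0 w) = inc1 (l1 (p1 b) w).
Proof.
rewrite pull1P; last by rewrite hom_ra proj_inc0 linear0r.
have [v {1}->] := ext_split1 b.
by rewrite linearDl /= -(hom_ra (ext_inc E)) (abelian_ra (abext_abelian E))
  linear0 addr0.
Qed.

Lemma ra_incl y m : cmra (inc1 m) y = inc1 (r01 (p0 y) m).
Proof.
rewrite pull1P; last by rewrite hom_ra proj_inc1 linear0l.
have [v {1}->] := ext_split0 y.
by rewrite linearDr /= -(hom_ra (ext_inc E)) (abelian_ra (abext_abelian E))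
  linear0 addr0.
Qed.

Definition ext_incE := (br_incr, br_incl, la_incr, la_incl, ra_incr, ra_incl).

Lemma inc_l00 x w : inc0 (l00 x w) = cmbr (s0 x) (inc0 w).
Proof. by rewrite br_incr sec0K. Qed.
Lemma inc_r00 x w : inc0 (r00 x w) = cmbr (inc0 w) (s0 x).
Proof. by rewrite br_incl sec0K. Qed.
Lemma inc_l01 x m : inc1 (l01 x m) = cmla (s0 x) (inc1 m).
Proof. by rewrite la_incr sec0K. Qed.
Lemma inc_r01 x m : inc1 (r01 x m) = cmra (inc1 m) (s0 x).
Proof. by rewrite ra_incl sec0K. Qed.
Lemma inc_l1 a w : inc1 (l1 a w) = cmra (s1 a) (inc0 w).
Proof. by rewrite ra_incr sec1K. Qed.
Lemma inc_r1 a w : inc1 (r1 a w) = cmla (inc0 w) (s1 a).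
Proof. by rewrite la_incl sec1K. Qed.

Definition inc_repE := (inc_l00, inc_r00, inc_l01, inc_r01, inc_l1, inc_r1).

Lemma l00_bilinear : is_bilinear l00.
Proof.
by split=> [x|w] k u v; apply: (@ext_inc0_inj _ _ E);
  rewrite !(linearP, inc_repE) /= (linearPl, linearPr).
Qed.
Lemma r00_bilinear : is_bilinear r00.
Proof.
by split=> [x|w] k u v; apply: (@ext_inc0_inj _ _ E);
  rewrite !(linearP, inc_repE) /= (linearPl, linearPr).
Qed.
Lemma l01_bilinear : is_bilinear l01.
Proof.
by split=> [x|w] k u v; apply: (@ext_inc1_inj _ _ E);
  rewrite !(linearP, inc_repE) /= (linearPl, linearPr).
Qed.
Lemma r01_bilinear : is_bilinear r01.
Proof.
by split=> [x|w] k u v; apply: (@ext_inc1_inj _ _ E);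
  rewrite !(linearP, inc_repE) /= (linearPl, linearPr).
Qed.
Lemma l1_bilinear : is_bilinear l1.
Proof.
by split=> [x|w] k u v; apply: (@ext_inc1_inj _ _ E);
  rewrite !(linearP, inc_repE) /= (linearPl, linearPr).
Qed.
Lemma r1_bilinear : is_bilinear r1.
Proof.
by split=> [x|w] k u v; apply: (@ext_inc1_inj _ _ E);
  rewrite !(linearP, inc_repE) /= (linearPl, linearPr).
Qed.

HB.instance Definition _ := bilinear_isBilinear.Build F _ _ _ _ _ l00
  (is_bilinear_for l00_bilinear).
HB.instance Definition _ := bilinear_isBilinear.Build F _ _ _ _ _ l01
  (is_bilinear_for l01_bilinear).
HB.instance Definition _ := bilinear_isBilinear.Build F _ _ _ _ _ r00
  (is_bilinear_for r00_bilinear).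
HB.instance Definition _ := bilinear_isBilinear.Build F _ _ _ _ _ r01
  (is_bilinear_for r01_bilinear).
HB.instance Definition _ := bilinear_isBilinear.Build F _ _ _ _ _ l1
  (is_bilinear_for l1_bilinear).
HB.instance Definition _ := bilinear_isBilinear.Build F _ _ _ _ _ r1
  (is_bilinear_for r1_bilinear).

Let homE := (hom_br, hom_la, hom_ra, sec0K, sec1K).

Lemma rep_l00_br x y w : l00 x (l00 y w) = l00 (cmbr x y) w + l00 y (l00 x w).
Proof.
have := (icm_leibniz (cmP hat)).2 (s0 x) (s0 y) (inc0 w).
by rewrite !ext_incE !homE -linearD => /(@ext_inc0_inj _ _ E) ->.
Qed.

Lemma rep_l00_r00 x y v : l00 x (r00 y v) = r00 y (l00 x v) + r00 (cmbr x y) v.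
Proof.
have := (icm_leibniz (cmP hat)).2 (s0 x) (inc0 v) (s0 y).
by rewrite !ext_incE !homE -linearD => /(@ext_inc0_inj _ _ E) ->.
Qed.

Lemma rep_r00_br x y u : r00 (cmbr x y) u = r00 y (r00 x u) + l00 x (r00 y u).
Proof.
have := (icm_leibniz (cmP hat)).2 (inc0 u) (s0 x) (s0 y).
by rewrite !ext_incE !homE -linearD => /(@ext_inc0_inj _ _ E) ->.
Qed.

Lemma rep_l01_br x y m : l01 (cmbr x y) m = l01 x (l01 y m) - l01 y (l01 x m).
Proof.
have := rep_la_br (icm_rep (cmP hat)) (s0 x) (s0 y) (inc1 m).
by rewrite !ext_incE !homE -linearB => /(@ext_inc1_inj _ _ E) ->.
Qed.

Lemma rep_r1_l00 x a v : r1 a (l00 x v) = l01 x (r1 a v) - r1 (cmla x a) v.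
Proof.
have := rep_la_br (icm_rep (cmP hat)) (s0 x) (inc0 v) (s1 a).
by rewrite !ext_incE !homE -linearB => /(@ext_inc1_inj _ _ E) ->.
Qed.

Lemma rep_r1_r00 y a u : r1 a (r00 y u) = r1 (cmla y a) u - l01 y (r1 a u).
Proof.
have := rep_la_br (icm_rep (cmP hat)) (inc0 u) (s0 y) (s1 a).
by rewrite !ext_incE !homE -linearB => /(@ext_inc1_inj _ _ E) ->.
Qed.

Lemma rep_r01_br x y m : r01 (cmbr x y) m = r01 y (r01 x m) + l01 x (r01 y m).
Proof.
have := rep_ra_br (icm_rep (cmP hat)) (s0 x) (s0 y) (inc1 m).
by rewrite !ext_incE !homE -linearD => /(@ext_inc1_inj _ _ E) ->.
Qed.

Lemma rep_l1_l00 x a v : l1 a (l00 x v) = l1 (cmra a x) v + l01 x (l1 a v).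
Proof.
have := rep_ra_br (icm_rep (cmP hat)) (s0 x) (inc0 v) (s1 a).
by rewrite !ext_incE !homE -linearD => /(@ext_inc1_inj _ _ E) ->.
Qed.

Lemma rep_l1_r00 y a u : l1 a (r00 y u) = r01 y (l1 a u) + r1 (cmra a y) u.
Proof.
have := rep_ra_br (icm_rep (cmP hat)) (inc0 u) (s0 y) (s1 a).
by rewrite !ext_incE !homE -linearD => /(@ext_inc1_inj _ _ E) ->.
Qed.

Lemma rep_r01_br' x y m : r01 (cmbr x y) m = l01 x (r01 y m) - r01 y (l01 x m).
Proof.
have := rep_la_ra (icm_rep (cmP hat)) (s0 x) (s0 y) (inc1 m).
by rewrite !ext_incE !homE -linearB => /(@ext_inc1_inj _ _ E) ->.
Qed.

Lemma rep_l1_l00' x a v : l1 a (l00 x v) = l01 x (l1 a v) - l1 (cmla x a) v.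
Proof.
have := rep_la_ra (icm_rep (cmP hat)) (s0 x) (inc0 v) (s1 a).
by rewrite !ext_incE !homE -linearB => /(@ext_inc1_inj _ _ E) ->.
Qed.

Lemma rep_l1_r00' y a u : l1 a (r00 y u) = r1 (cmra a y) u - r01 y (r1 a u).
Proof.
have := rep_la_ra (icm_rep (cmP hat)) (inc0 u) (s0 y) (s1 a).
by rewrite !ext_incE !homE -linearB => /(@ext_inc1_inj _ _ E) ->.
Qed.

Let inc_f m : cmf (inc1 m) = inc0 (cmf m).
Proof. by rewrite hom_f. Qed.

Lemma rep_f_l01 x m : cmf (l01 x m) = l00 x (cmf m).
Proof.
have := icm_la (cmP hat) (s0 x) (inc1 m).
by rewrite inc_f !ext_incE inc_f !homE => ?; apply: (@ext_inc0_inj _ _ E).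
Qed.

Lemma rep_f_r1 a u : cmf (r1 a u) = r00 (cmf a) u.
Proof.
have := icm_la (cmP hat) (inc0 u) (s1 a).
by rewrite !ext_incE hom_f !homE inc_f => ?; apply: (@ext_inc0_inj _ _ E).
Qed.

Lemma rep_f_l1 a u : cmf (l1 a u) = l00 (cmf a) u.
Proof.
have := icm_ra (cmP hat) (inc0 u) (s1 a).
by rewrite !ext_incE hom_f !homE inc_f => ?; apply: (@ext_inc0_inj _ _ E).
Qed.

Lemma rep_f_r01 x m : cmf (r01 x m) = r00 x (cmf m).
Proof.
have := icm_ra (cmP hat) (s0 x) (inc1 m).
by rewrite inc_f !ext_incE inc_f !homE => ?; apply: (@ext_inc0_inj _ _ E).
Qed.

Lemma rep_l01_f a n : l01 (cmf a) n = l1 a (cmf n).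
Proof.
have := icm_peiffer (cmP hat) (s1 a) (inc1 n).
by rewrite inc_f !ext_incE hom_f !homE => ?; apply: (@ext_inc1_inj _ _ E).
Qed.

Lemma rep_r01_f a m : r01 (cmf a) m = r1 a (cmf m).
Proof.
have := icm_peiffer (cmP hat) (inc1 m) (s1 a).
by rewrite inc_f !ext_incE hom_f !homE => ?; apply: (@ext_inc1_inj _ _ E).
Qed.

Record cocycle_eqs (c : cochain2) : Prop := CocycleEqs {
  ceq_leibniz : forall x y z,
    com c x (cmbr y z) + l00 x (com c y z) =
    com c (cmbr x y) z + r00 z (com c x y)
    + (com c y (cmbr x z) + l00 y (com c x z));
  ceq_la_br : forall x y a,
    cmu c (cmbr x y) a + r1 a (com c x y) =
    cmu c x (cmla y a) + l01 x (cmu c y a)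
    - (cmu c y (cmla x a) + l01 y (cmu c x a));
  ceq_ra_br : forall x y a,
    cnu c a (cmbr x y) + l1 a (com c x y) =
    cnu c (cmra a x) y + r01 y (cnu c a x)
    + (cmu c x (cmra a y) + l01 x (cnu c a y));
  ceq_la_ra : forall x y a,
    cnu c a (cmbr x y) + l1 a (com c x y) =
    cmu c x (cmra a y) + l01 x (cnu c a y)
    - (cnu c (cmla x a) y + r01 y (cmu c x a));
  ceq_f_la : forall x a,
    cth c (cmla x a) + cmf (cmu c x a) = com c x (cmf a) + l00 x (cth c a);
  ceq_f_ra : forall x a,
    cth c (cmra a x) + cmf (cnu c a x) = com c (cmf a) x + r00 x (cth c a);
  ceq_peiffer : forall a b,
    cmu c (cmf a) b + r1 b (cth c a) = cnu c a (cmf b) + l1 a (cth c b) }.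

Lemma is_cocycle2_eqs c : is_cocycle2 c -> cocycle_eqs c.
Proof.
case=> _ [lei rep _ fla fra pei]; split.
- move=> x y z; have := congr1 snd (lei.2 (x, 0) (y, 0) (z, 0)).
  by rewrite /= !(linear0r, linear0l, addr0).
- move=> x y a; have := congr1 snd (rep_la_br rep (x, 0) (y, 0) (a, 0)).
  by rewrite /= !(linear0r, linear0l, addr0, add0r).
- move=> x y a; have := congr1 snd (rep_ra_br rep (x, 0) (y, 0) (a, 0)).
  by rewrite /= !(linear0r, linear0l, addr0, add0r).
- move=> x y a; have := congr1 snd (rep_la_ra rep (x, 0) (y, 0) (a, 0)).
  by rewrite /= !(linear0r, linear0l, addr0, add0r).
- move=> x a; have := congr1 snd (fla (x, 0) (a, 0)).
  by rewrite /= !(linear0, linear0r, linear0l, addr0, add0r).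
- move=> x a; have := congr1 snd (fra (x, 0) (a, 0)).
  by rewrite /= !(linear0, linear0r, linear0l, addr0, add0r).
- move=> a b; have := congr1 snd (pei (a, 0) (b, 0)).
  by rewrite /= !(linear0, linear0r, linear0l, addr0, add0r).
Qed.

Let linear_add3 (M N : lmodType F) (f g h : M -> N) :
  linear f -> linear g -> linear h -> linear (fun x => f x + g x + h x).
Proof.
move=> lf lg lh k u v; rewrite lf lg lh !scalerDr !addrA.
by rewrite [LHS](ACl (1*3*5*2*4*6)).
Qed.

Let linear_fst (M M' N : lmodType F) (f : M -> N) :
  linear f -> linear (fun x : M * M' => f x.1).
Proof. by move=> lf k u v; rewrite /= lf. Qed.

Let linear_snd (M M' N : lmodType F) (f : M -> N) :
  linear f -> linear (fun x : M' * M => f x.2).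
Proof. by move=> lf k u v; rewrite /= lf. Qed.

Let linear_pair (M N N' : lmodType F) (f : M -> N) (g : M -> N') :
  linear f -> linear g -> linear (fun x => (f x, g x)).
Proof. by move=> lf lg k u v; rewrite /= lf lg. Qed.

Lemma cocycle_eqs_is c : is_cochain2 c -> cocycle_eqs c -> is_cocycle2 c.
Proof.
move=> ch ce; split=> //.
have [lei rep lf fla fra pei] := cmP P.
split; last 4 first.
- apply: linear_pair; first exact: linear_fst.
  move=> k [a m] [b n] /=; rewrite (cochain2_th ch) linearP /=.
  by rewrite scalerDr addrACA.
- move=> [x u] [a m]; congr (_, _); first exact: fla.
  rewrite /= !(linearDr, linearD) /= rep_f_r1 rep_f_l01.
  by rewrite !addrA (ceq_f_la ce).
- move=> [x u] [a m]; congr (_, _); first exact: fra.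
  rewrite /= !(linearDr, linearD) /= rep_f_l1 rep_f_r01.
  by rewrite !addrA (ceq_f_ra ce) [in LHS](addrAC _ (r00 _ _)).
- move=> [a m] [b n]; congr (_, _); first exact: pei.
  rewrite /= !(linearDr, linearD) /= rep_l01_f rep_r01_f.
  by rewrite !addrA [LHS](ACl ((1*3)*(2*4))) /= (ceq_peiffer ce) !addrA.
- split; first split.
  + move=> [x u]; apply: linear_pair; first exact: (linear_fst (lei.1.1 x)).
    apply: linear_add3; first exact: (linear_fst ((cochain2_om ch).1 x)).
      exact: (linear_snd (l00_bilinear.1 x)).
    exact: (linear_fst (r00_bilinear.2 u)).
  + move=> [y v]; apply: linear_pair; first exact: (linear_fst (lei.1.2 y)).
    apply: linear_add3; first exact: (linear_fst ((cochain2_om ch).2 y)).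
      exact: (linear_fst (l00_bilinear.2 v)).
    exact: (linear_snd (r00_bilinear.1 y)).
  + move=> [x u] [y v] [z w]; congr (_, _); first exact: lei.2.
    rewrite /= !(linearDr, linearDl) /= rep_l00_br rep_l00_r00 (rep_r00_br y z).
    rewrite !addrA [LHS](ACl ((1*2)*(3*4*5*6*7*8))) /= (ceq_leibniz ce) !addrA.
    by rewrite [LHS](ACl (1*5*2*7*9*3*4*6*10*8)).
- split.
  + split=> [[x u]|[a m]].
      apply: linear_pair; first exact: (linear_fst ((rep_la_bilin rep).1 x)).
      apply: linear_add3; first exact: (linear_fst ((cochain2_mu ch).1 x)).
        exact: (linear_snd (l01_bilinear.1 x)).
      exact: (linear_fst (r1_bilinear.2 u)).
    apply: linear_pair; first exact: (linear_fst ((rep_la_bilin rep).2 a)).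
    apply: linear_add3; first exact: (linear_fst ((cochain2_mu ch).2 a)).
      exact: (linear_fst (l01_bilinear.2 m)).
    exact: (linear_snd (r1_bilinear.1 a)).
  + split=> [[a m]|[x u]].
      apply: linear_pair; first exact: (linear_fst ((rep_ra_bilin rep).1 a)).
      apply: linear_add3; first exact: (linear_fst ((cochain2_nu ch).1 a)).
        exact: (linear_snd (l1_bilinear.1 a)).
      exact: (linear_fst (r01_bilinear.2 m)).
    apply: linear_pair; first exact: (linear_fst ((rep_ra_bilin rep).2 x)).
    apply: linear_add3; first exact: (linear_fst ((cochain2_nu ch).2 x)).
      exact: (linear_fst (l1_bilinear.2 u)).
    exact: (linear_snd (r01_bilinear.1 x)).
  + move=> [x u] [y v] [a m]; congr (_, _); first exact: (rep_la_br rep).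
    rewrite /= !(linearDr, linearDl) /= rep_l01_br rep_r1_l00 rep_r1_r00.
    rewrite !opprD !addrA [LHS](ACl ((1*4)*(2*3*5*6*7*8))) /= (ceq_la_br ce).
    by rewrite !opprD !addrA [LHS](ACl (1*2*5*7*9*3*4*6*10*8)).
  + move=> [x u] [y v] [a m]; congr (_, _); first exact: (rep_ra_br rep).
    rewrite /= !(linearDr, linearDl) /= rep_r01_br rep_l1_l00 rep_l1_r00.
    rewrite !addrA [LHS](ACl ((1*2)*(3*4*5*6*7*8))) /= (ceq_ra_br ce) !addrA.
    by rewrite [LHS](ACl (1*5*2*7*9*3*4*6*10*8)).
  + move=> [x u] [y v] [a m]; congr (_, _); first exact: (rep_la_ra rep).
    rewrite /= !(linearDr, linearDl) /= rep_r01_br' rep_l1_l00' rep_l1_r00'.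
    rewrite !opprD !addrA [LHS](ACl ((1*2)*(3*4*5*6*7*8))) /= (ceq_la_ra ce).
    by rewrite !opprD !addrA [LHS](ACl (1*2*5*9*7*3*6*4*10*8)).
Qed.

Let is_bilinear0 (M M' N : lmodType F) :
  is_bilinear (fun (_ : M) (_ : M') => 0 : N).
Proof. by split=> ? k u v /=; rewrite scaler0 addr0. Qed.

Let is_bilinearB (M M' N : lmodType F) (f g : M -> M' -> N) :
  is_bilinear f -> is_bilinear g -> is_bilinear (f - g).
Proof.
move=> [fr fl] [gr gl]; split=> [x|y]; first exact: linear_funB.
exact: (linear_funB (fl y) (gl y)).
Qed.

Lemma is_cochain2_0 : is_cochain2 0.
Proof.
split; last 3 first; try exact: is_bilinear0.
by move=> k u v /=; rewrite scaler0 addr0.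
Qed.

Lemma cthB c c' : cth (c - c') = cth c - cth c'.
Proof. by rewrite /cth !raddfB. Qed.
Lemma comB c c' : com (c - c') = com c - com c'.
Proof. by rewrite /com !raddfB. Qed.
Lemma cmuB c c' : cmu (c - c') = cmu c - cmu c'.
Proof. by rewrite /cmu !raddfB. Qed.
Lemma cnuB c c' : cnu (c - c') = cnu c - cnu c'.
Proof. by rewrite /cnu !raddfB. Qed.

Lemma is_cochain2B c c' : is_cochain2 c -> is_cochain2 c' -> is_cochain2 (c - c').
Proof.
move=> h h'; split; rewrite ?(cthB, comB, cmuB, cnuB).
- exact: linear_funB (cochain2_th h) (cochain2_th h').
- exact: is_bilinearB (cochain2_om h) (cochain2_om h').
- exact: is_bilinearB (cochain2_mu h) (cochain2_mu h').
- exact: is_bilinearB (cochain2_nu h) (cochain2_nu h').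
Qed.

Lemma is_cocycle2_0 : is_cocycle2 0.
Proof.
apply: cocycle_eqs_is; first exact: is_cochain2_0.
have th0 a : cth 0 a = 0 by [].
have om0 x y : com 0 x y = 0 by [].
have mu0 x a : cmu 0 x a = 0 by [].
have nu0 a x : cnu 0 a x = 0 by [].
by split=> *; rewrite !(th0, om0, mu0, nu0) ?linear0 ?linear0r !(addr0, subr0).
Qed.

Lemma is_cocycle2B c c' :
  is_cocycle2 c -> is_cocycle2 c' -> is_cocycle2 (c - c').
Proof.
move=> cc cc'; have [ch _] := cc; have [ch' _] := cc'.
apply: cocycle_eqs_is; first exact: is_cochain2B.
have ce := is_cocycle2_eqs cc; have ce' := is_cocycle2_eqs cc'.
have thB a : cth (c - c') a = cth c a - cth c' a by rewrite cthB.
have omB x y : com (c - c') x y = com c x y - com c' x y by rewrite comB.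
have muB x a : cmu (c - c') x a = cmu c x a - cmu c' x a by rewrite cmuB.
have nuB a x : cnu (c - c') a x = cnu c a x - cnu c' a x by rewrite cnuB.
split.
- move=> x y z; rewrite !omB !linearBr /= (addrACA (com c x _)) -opprD.
  rewrite (ceq_leibniz ce) (ceq_leibniz ce') !opprD !addrA.
  by rewrite [LHS](ACl (1*5*2*6*3*7*4*8)).
- move=> x y a; rewrite !muB !omB !linearBr /= (addrACA (cmu c (cmbr x y) a)).
  rewrite -opprD (ceq_la_br ce) (ceq_la_br ce') !opprD !opprK !addrA.
  by rewrite [LHS](ACl (1*5*2*6*3*7*4*8)).
- move=> x y a; rewrite !muB !nuB !omB !linearBr /=.
  rewrite (addrACA (cnu c a (cmbr x y))).
  rewrite -opprD (ceq_ra_br ce) (ceq_ra_br ce') !opprD !addrA.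
  by rewrite [LHS](ACl (1*5*2*6*3*7*4*8)).
- move=> x y a; rewrite !muB !nuB !omB !linearBr /=.
  rewrite (addrACA (cnu c a (cmbr x y))).
  rewrite -opprD (ceq_la_ra ce) (ceq_la_ra ce') !opprD !opprK !addrA.
  by rewrite [LHS](ACl (1*5*2*6*3*7*4*8)).
- move=> x a; rewrite !thB !muB !omB linearBr linearB /= addrACA -opprD.
  by rewrite (ceq_f_la ce) (ceq_f_la ce') opprD addrACA.
- move=> x a; rewrite !thB !nuB !omB linearBr linearB /= addrACA -opprD.
  by rewrite (ceq_f_ra ce) (ceq_f_ra ce') opprD addrACA.
- move=> a b; rewrite !thB !muB !nuB !linearBr /= addrACA -opprD.
  by rewrite (ceq_peiffer ce) (ceq_peiffer ce') opprD addrACA.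
Qed.

Lemma f_sec a : cmf (s1 a) = s0 (cmf a) + inc0 (cth ext_cocycle a).
Proof.
rewrite pull0P; first by rewrite addrC subrK.
by rewrite linearB /= hom_f sec0K sec1K subrr.
Qed.

Lemma br_sec x y :
  cmbr (s0 x) (s0 y) = s0 (cmbr x y) + inc0 (com ext_cocycle x y).
Proof.
rewrite pull0P; first by rewrite addrC subrK.
by rewrite linearB /= hom_br !sec0K subrr.
Qed.

Lemma la_sec x a :
  cmla (s0 x) (s1 a) = s1 (cmla x a) + inc1 (cmu ext_cocycle x a).
Proof.
rewrite pull1P; first by rewrite addrC subrK.
by rewrite linearB /= hom_la sec0K !sec1K subrr.
Qed.

Lemma ra_sec x a :
  cmra (s1 a) (s0 x) = s1 (cmra a x) + inc1 (cnu ext_cocycle a x).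
Proof.
rewrite pull1P; first by rewrite addrC subrK.
by rewrite linearB /= hom_ra sec0K !sec1K subrr.
Qed.

Let scaleBB (M : lmodType F) k (a b a' b' : M) :
  k *: a + b - (k *: a' + b') = k *: (a - a') + (b - b').
Proof. by rewrite scalerBr opprD addrACA. Qed.

Lemma inc_cth a : inc0 (cth ext_cocycle a) = cmf (s1 a) - s0 (cmf a).
Proof. by rewrite f_sec addrC addKr. Qed.
Lemma inc_com x y :
  inc0 (com ext_cocycle x y) = cmbr (s0 x) (s0 y) - s0 (cmbr x y).
Proof. by rewrite br_sec addrC addKr. Qed.
Lemma inc_cmu x a :
  inc1 (cmu ext_cocycle x a) = cmla (s0 x) (s1 a) - s1 (cmla x a).
Proof. by rewrite la_sec addrC addKr. Qed.
Lemma inc_cnu a x :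
  inc1 (cnu ext_cocycle a x) = cmra (s1 a) (s0 x) - s1 (cmra a x).
Proof. by rewrite ra_sec addrC addKr. Qed.

Lemma is_cochain2_ext_cocycle : is_cochain2 ext_cocycle.
Proof.
split.
- move=> k a b; apply: (@ext_inc0_inj _ _ E).
  by rewrite [RHS]linearP !inc_cth !linearP -scaleBB /= !linearP.
- split=> [x|y] k u v; apply: (@ext_inc0_inj _ _ E);
    rewrite [RHS]linearP !inc_com -scaleBB /=.
    by rewrite linearPr [s0 (_ + _)]linearP linearPr linearP.
  by rewrite linearPl [s0 (_ + _)]linearP linearPl linearP.
- split=> [x|y] k u v; apply: (@ext_inc1_inj _ _ E);
    rewrite [RHS]linearP !inc_cmu -scaleBB /=.
    by rewrite linearPr [s1 (_ + _)]linearP linearPr linearP.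
  by rewrite linearPl [s0 (_ + _)]linearP linearPl linearP.
- split=> [x|y] k u v; apply: (@ext_inc1_inj _ _ E);
    rewrite [RHS]linearP !inc_cnu -scaleBB /=.
    by rewrite linearPr [s0 (_ + _)]linearP linearPr linearP.
  by rewrite linearPl [s1 (_ + _)]linearP linearPl linearP.
Qed.

Let cancel2 (M : zmodType) (p a b c d : M) :
  p + a + b = p + c + d -> a + b = c + d.
Proof. by rewrite -!addrA => /addrI. Qed.

Let cancel4 (M : zmodType) (p q a b c d e f : M) :
  p + q + a + b = p + c + d + (q + e + f) -> a + b = c + d + (e + f).
Proof.
rewrite !addrA [X in _ = X](ACl (1*4*2*3*5*6)) /= -!addrA => /addrI /addrI ->.
by [].
Qed.

Lemma is_cocycle2_ext_cocycle : is_cocycle2 ext_cocycle.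
Proof.
apply: cocycle_eqs_is; first exact: is_cochain2_ext_cocycle.
have [lei rep _ fla fra pei] := cmP hat.
have [leiP repP _ flaP fraP peiP] := cmP P.
move: f_sec br_sec la_sec ra_sec; move: ext_cocycle => c fS bS lS rS.
split.
- move=> x y z; apply: (@ext_inc0_inj _ _ E).
  have := lei.2 (s0 x) (s0 y) (s0 z).
  rewrite !bS !(linearDr, linearDl) /= !bS !ext_incE !sec0K.
  by rewrite leiP.2 !linearD /=; apply: cancel4.
- move=> x y a; apply: (@ext_inc1_inj _ _ E).
  have := rep_la_br rep (s0 x) (s0 y) (s1 a).
  rewrite !bS !lS !(linearDr, linearDl) /= !lS !ext_incE.
  rewrite ?sec0K ?sec1K (rep_la_br repP) !(linearB, linearD) /=.
  exact: cancel4.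
- move=> x y a; apply: (@ext_inc1_inj _ _ E).
  have := rep_ra_br rep (s0 x) (s0 y) (s1 a).
  rewrite !bS !rS !(linearDr, linearDl) /= !rS !lS !ext_incE.
  rewrite ?sec0K ?sec1K (rep_ra_br repP) !(linearB, linearD) /=.
  exact: cancel4.
- move=> x y a; apply: (@ext_inc1_inj _ _ E).
  have := rep_la_ra rep (s0 x) (s0 y) (s1 a).
  rewrite !bS !lS !rS !(linearDr, linearDl) /= !rS !lS.
  rewrite !ext_incE ?sec0K ?sec1K (rep_la_ra repP) !(linearB, linearD) /=.
  exact: cancel4.
- move=> x a; apply: (@ext_inc0_inj _ _ E).
  have := fla (s0 x) (s1 a).
  rewrite lS fS linearDr linearD /= fS bS !ext_incE sec0K.
  by rewrite flaP !linearD /= -(hom_f (ext_inc E)); apply: cancel2.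
- move=> x a; apply: (@ext_inc0_inj _ _ E).
  have := fra (s0 x) (s1 a).
  rewrite rS fS linearDl linearD /= fS bS !ext_incE sec0K.
  by rewrite fraP !linearD /= -(hom_f (ext_inc E)); apply: cancel2.
- move=> a b; apply: (@ext_inc1_inj _ _ E).
  have := pei (s1 a) (s1 b).
  rewrite !fS linearDl linearDr /= lS rS !ext_incE !sec1K.
  by rewrite peiP !linearD /=; apply: cancel2.
Qed.

End Cohomology.

Arguments cth : simpl never.
Arguments com : simpl never.
Arguments cmu : simpl never.
Arguments cnu : simpl never.

Section Groups.
Variables (V P : crossed_module) (E : abelian_extension V P).
Variable s : ext_section E.

Local Notation hat := (ext_tot E).
Local Notation inc0 := (hom0 (ext_inc E)).
Local Notation inc1 := (hom1 (ext_inc E)).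
Local Notation p0 := (hom0 (ext_proj E)).
Local Notation p1 := (hom1 (ext_proj E)).
Local Notation s0 := (sec0 s).
Local Notation s1 := (sec1 s).

Lemma is_cochain1_0 : is_cochain1 (0 : cochain1 V P).
Proof. by split=> k u v /=; rewrite scaler0 addr0. Qed.

Lemma is_cochain1B (h h' : cochain1 V P) :
  is_cochain1 h -> is_cochain1 h' -> is_cochain1 (h - h').
Proof.
move=> lh lh'; split; rewrite raddfB.
  exact: linear_funB (cochain1_lin0 lh) (cochain1_lin0 lh').
exact: linear_funB (cochain1_lin1 lh) (cochain1_lin1 lh').
Qed.

Lemma cochain2P (c c' : cochain2 V P) :
  cth c =1 cth c' -> com c =2 com c' -> cmu c =2 cmu c' -> cnu c =2 cnu c' ->
  c = c'.
Proof.
case: c c' => [[[th om] mu] nu] [[[th' om'] mu'] nu'].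
rewrite /cth /com /cmu /cnu /= => eth eom emu enu.
by congr (_, _, _, _); apply/funext => x //; apply/funext => y.
Qed.

Let subBB (M : zmodType) (a b a' b' : M) : a - a' - (b - b') = a - b - (a' - b').
Proof. by rewrite !opprD !opprK addrACA. Qed.

Let subDD (M : zmodType) (a b c a' b' c' : M) :
  (a - a') + (b - b') - (c - c') = a + b - c - (a' + b' - c').
Proof. by rewrite !opprD !opprK !addrA [LHS](ACl (1*3*5*2*4*6)). Qed.

Lemma cth_coboundary h a :
  cth (coboundary s h) a = cmf (h.2 a) - h.1 (cmf a).
Proof. by []. Qed.
Lemma com_coboundary h x y : com (coboundary s h) x y =
  l00 s x (h.1 y) + r00 s y (h.1 x) - h.1 (cmbr x y).
Proof. by []. Qed.
Lemma cmu_coboundary h x a : cmu (coboundary s h) x a =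
  l01 s x (h.2 a) + r1 s a (h.1 x) - h.2 (cmla x a).
Proof. by []. Qed.
Lemma cnu_coboundary h a x : cnu (coboundary s h) a x =
  l1 s a (h.1 x) + r01 s x (h.2 a) - h.2 (cmra a x).
Proof. by []. Qed.

Lemma coboundaryB h h' :
  coboundary s (h - h') = coboundary s h - coboundary s h'.
Proof.
have h0B x : (h - h').1 x = h.1 x - h'.1 x by rewrite raddfB.
have h1B a : (h - h').2 a = h.2 a - h'.2 a by rewrite raddfB.
apply: cochain2P => [a|x y|x a|a x].
- by rewrite cthB /= !cth_coboundary h0B h1B linearB subBB.
- by rewrite comB !com_coboundary !h0B !linearBr subDD.
- by rewrite cmuB !cmu_coboundary h0B !h1B !linearBr subDD.
- by rewrite cnuB !cnu_coboundary h0B !h1B !linearBr subDD.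
Qed.

Lemma coboundary0 : coboundary s 0 = 0.
Proof. by rewrite -[X in coboundary s X](subrr 0) coboundaryB subrr. Qed.

Section Shift.
Variables (h : cochain1 V P) (hP : is_cochain1 h).

Definition shift0 (x : cm0 P) : cm0 hat := s0 x + inc0 (h.1 x).
Definition shift1 (a : cm1 P) : cm1 hat := s1 a + inc1 (h.2 a).

Let shift0_linear : linear shift0.
Proof.
by move=> k u v; rewrite /shift0 (cochain1_lin0 hP) !linearP scalerDr addrACA.
Qed.
Let shift1_linear : linear shift1.
Proof.
by move=> k u v; rewrite /shift1 (cochain1_lin1 hP) !linearP scalerDr addrACA.
Qed.

HB.instance Definition _ :=
  GRing.isLinear.Build F (cm0 P) (cm0 hat) *:%R shift0 shift0_linear.
HB.instance Definition _ :=
  GRing.isLinear.Build F (cm1 P) (cm1 hat) *:%R shift1 shift1_linear.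

Let shift0K : cancel shift0 p0.
Proof. by move=> x; rewrite linearD /= sec0K proj_inc0 addr0. Qed.
Let shift1K : cancel shift1 p1.
Proof. by move=> x; rewrite linearD /= sec1K proj_inc1 addr0. Qed.

Definition shift_section : ext_section E := ExtSection shift0K shift1K.

Lemma l00_shift : l00 shift_section = l00 s.
Proof.
apply/funext => x; apply/funext => w; apply: (@ext_inc0_inj _ _ E).
by rewrite inc_l00 (br_incr s) shift0K.
Qed.
Lemma r00_shift : r00 shift_section = r00 s.
Proof.
apply/funext => x; apply/funext => w; apply: (@ext_inc0_inj _ _ E).
by rewrite inc_r00 (br_incl s) shift0K.
Qed.
Lemma l01_shift : l01 shift_section = l01 s.
Proof.
apply/funext => x; apply/funext => w; apply: (@ext_inc1_inj _ _ E).
by rewrite inc_l01 (la_incr s) shift0K.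
Qed.
Lemma r01_shift : r01 shift_section = r01 s.
Proof.
apply/funext => x; apply/funext => w; apply: (@ext_inc1_inj _ _ E).
by rewrite inc_r01 (ra_incl s) shift0K.
Qed.
Lemma l1_shift : l1 shift_section = l1 s.
Proof.
apply/funext => x; apply/funext => w; apply: (@ext_inc1_inj _ _ E).
by rewrite inc_l1 (ra_incr s) shift1K.
Qed.
Lemma r1_shift : r1 shift_section = r1 s.
Proof.
apply/funext => x; apply/funext => w; apply: (@ext_inc1_inj _ _ E).
by rewrite inc_r1 (la_incl s) shift1K.
Qed.

Lemma is_cocycle2_shift c : is_cocycle2 shift_section c = is_cocycle2 s c.
Proof.
rewrite /is_cocycle2 /twist_br /twist_la /twist_ra.
by rewrite l00_shift r00_shift l01_shift r01_shift l1_shift r1_shift.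
Qed.

Let subDB (M : zmodType) (x y u v : M) : x + u - (y + v) - (x - y) = u - v.
Proof. by rewrite (opprD y v) addrACA [X in X - _]addrC addrK. Qed.

Lemma coboundary_shift :
  coboundary s h = ext_cocycle shift_section - ext_cocycle s.
Proof.
have [abr ala ara] := abext_abelian E.
apply: cochain2P => [a|x y|x a|a x].
- apply: (@ext_inc0_inj _ _ E).
  rewrite cthB cth_coboundary !linearB /= !inc_cth /= /shift0 /shift1.
  by rewrite linearD /= -(hom_f (ext_inc E)) subDB.
- apply: (@ext_inc0_inj _ _ E).
  rewrite comB com_coboundary !linearB /= !inc_com /= /shift0.
  rewrite linearDl !linearDr /= -!(hom_br (ext_inc E)) abr linear0 addr0.
  by rewrite -(addrA (cmbr _ (s0 y))) subDB linearD /= inc_l00 inc_r00.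
- apply: (@ext_inc1_inj _ _ E).
  rewrite cmuB cmu_coboundary !linearB /= !inc_cmu /= /shift0 /shift1.
  rewrite linearDl !linearDr /= -!(hom_la (ext_inc E)) ala linear0 addr0.
  by rewrite -(addrA (cmla _ (s1 a))) subDB linearD /= inc_l01 inc_r1.
- apply: (@ext_inc1_inj _ _ E).
  rewrite cnuB cnu_coboundary !linearB /= !inc_cnu /= /shift0 /shift1.
  rewrite linearDl !linearDr /= -!(hom_ra (ext_inc E)) ara linear0 addr0.
  by rewrite -(addrA (cmra _ (s0 x))) subDB linearD /= inc_l1 inc_r01.
Qed.

Lemma is_cocycle2_coboundary : is_cocycle2 s (coboundary s h).
Proof.
rewrite coboundary_shift; apply: is_cocycle2B.
  by rewrite -is_cocycle2_shift; apply: is_cocycle2_ext_cocycle.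
exact: is_cocycle2_ext_cocycle.
Qed.

End Shift.

Lemma is_cocycle1_0 : is_cocycle1 s 0.
Proof. by split; [exact: is_cochain1_0 | exact: coboundary0]. Qed.

Lemma is_cocycle1B h h' :
  is_cocycle1 s h -> is_cocycle1 s h' -> is_cocycle1 s (h - h').
Proof.
move=> [lh dh] [lh' dh']; split; first exact: is_cochain1B.
by rewrite coboundaryB dh dh' subrr.
Qed.

Definition Z1_subgroup := Subgroup is_cocycle1_0 is_cocycle1B.
Definition Z1 : zmodType := sg_type Z1_subgroup.

Definition Z2_subgroup := Subgroup (is_cocycle2_0 s) (@is_cocycle2B _ _ _ s).
Definition Z2 : zmodType := sg_type Z2_subgroup.

(* By is_cocycle2_coboundary, coboundary s h is in Z2 for every linear h, so
   these are all the coboundaries. *)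
Definition is_coboundary (c : Z2) : Prop :=
  exists h, is_cochain1 h /\ sg_val c = coboundary s h.

Lemma is_coboundary0 : is_coboundary 0.
Proof.
by exists 0; split; [exact: is_cochain1_0 | rewrite coboundary0 raddf0].
Qed.

Lemma is_coboundaryB c c' :
  is_coboundary c -> is_coboundary c' -> is_coboundary (c - c').
Proof.
move=> [h [lh ch]] [h' [lh' ch']]; exists (h - h'); split; first exact: is_cochain1B.
by rewrite coboundaryB -ch -ch' raddfB.
Qed.

Definition B2_subgroup := Subgroup is_coboundary0 is_coboundaryB.
Definition H2 : zmodType := sg_quot B2_subgroup.
Definition H2_class (c : Z2) : H2 := sg_pi B2_subgroup c.

Definition preserves_sub (D : Der hat) : Prop :=
  (forall v, exists v', der0 D (inc0 v) = inc0 v') /\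
  (forall m, exists m', der1 D (inc1 m) = inc1 m').

Lemma preserves_sub0 : preserves_sub 0.
Proof.
split=> u; exists 0; by rewrite linear0 /der0 /der1 raddf0.
Qed.

Lemma preserves_subB D D' :
  preserves_sub D -> preserves_sub D' -> preserves_sub (D - D').
Proof.
move=> [d0 d1] [d0' d1']; split=> [v|m].
  have [u uE] := d0 v; have [u' u'E] := d0' v; exists (u - u').
  by rewrite linearB /der0 raddfB /= -uE -u'E.
have [u uE] := d1 m; have [u' u'E] := d1' m; exists (u - u').
by rewrite linearB /der1 raddfB /= -uE -u'E.
Qed.

Definition DerV_subgroup := Subgroup preserves_sub0 preserves_subB.
Definition DerV : zmodType := sg_type DerV_subgroup.

Record rho_compatible (ba : Der V * Der P) : Prop := RhoCompatible {
  rc_l00 : forall x v, der0 ba.1 (l00 s x v) =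
    l00 s (der0 ba.2 x) v + l00 s x (der0 ba.1 v);
  rc_r00 : forall x v, der0 ba.1 (r00 s x v) =
    r00 s (der0 ba.2 x) v + r00 s x (der0 ba.1 v);
  rc_l01 : forall x m, der1 ba.1 (l01 s x m) =
    l01 s (der0 ba.2 x) m + l01 s x (der1 ba.1 m);
  rc_r01 : forall x m, der1 ba.1 (r01 s x m) =
    r01 s (der0 ba.2 x) m + r01 s x (der1 ba.1 m);
  rc_l1 : forall a v, der1 ba.1 (l1 s a v) =
    l1 s (der1 ba.2 a) v + l1 s a (der0 ba.1 v);
  rc_r1 : forall a v, der1 ba.1 (r1 s a v) =
    r1 s (der1 ba.2 a) v + r1 s a (der0 ba.1 v) }.

Lemma rho_compatible0 : rho_compatible 0.
Proof.
have z0 (C : crossed_module) x : der0 (0 : Der C) x = 0.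
  by rewrite /der0 raddf0.
have z1 (C : crossed_module) a : der1 (0 : Der C) a = 0.
  by rewrite /der1 raddf0.
by split=> *; rewrite !(z0, z1) linear0l linear0r addr0.
Qed.

Lemma rho_compatibleB ba ba' :
  rho_compatible ba -> rho_compatible ba' -> rho_compatible (ba - ba').
Proof.
move=> [l0 r0 l0' r0' ll rr] [k0 q0 k0' q0' kk qq].
have B0 (C : crossed_module) (D D' : Der C) x :
  der0 (D - D') x = der0 D x - der0 D' x by rewrite /der0 raddfB.
have B1 (C : crossed_module) (D D' : Der C) a :
  der1 (D - D') a = der1 D a - der1 D' a by rewrite /der1 raddfB.
split=> *; rewrite !raddfB !(B0, B1).
- by rewrite l0 k0 linearBl linearBr opprD addrACA.
- by rewrite r0 q0 linearBl linearBr opprD addrACA.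
- by rewrite l0' k0' linearBl linearBr opprD addrACA.
- by rewrite r0' q0' linearBl linearBr opprD addrACA.
- by rewrite ll kk linearBl linearBr opprD addrACA.
- by rewrite rr qq linearBl linearBr opprD addrACA.
Qed.

Definition Drho_subgroup := Subgroup rho_compatible0 rho_compatibleB.
Definition Drho : zmodType := sg_type Drho_subgroup.

Definition wells_cochain (ba : Der V * Der P) (c : cochain2 V P)
    : cochain2 V P :=
  (fun a => der0 ba.1 (cth c a) - cth c (der1 ba.2 a),
   fun x y => der0 ba.1 (com c x y) - com c (der0 ba.2 x) y
              - com c x (der0 ba.2 y),
   fun x a => der1 ba.1 (cmu c x a) - cmu c (der0 ba.2 x) a
              - cmu c x (der1 ba.2 a),
   fun a x => der1 ba.1 (cnu c a x) - cnu c (der1 ba.2 a) x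
              - cnu c a (der0 ba.2 x)).

Definition is_inclusion_map (i : Z1 -> DerV) : Prop := forall h : Z1,
  (forall x v,
     der0 (sg_val (i h)) (s0 x + inc0 v) = inc0 ((sg_val h).1 x)) /\
  (forall a m,
     der1 (sg_val (i h)) (s1 a + inc1 m) = inc1 ((sg_val h).2 a)).

Definition is_restriction_map (Phi : DerV -> Drho) : Prop := forall D : DerV,
  let: (beta, alpha) := sg_val (Phi D) in
  [/\ forall v, inc0 (der0 beta v) = der0 (sg_val D) (inc0 v),
      forall m, inc1 (der1 beta m) = der1 (sg_val D) (inc1 m),
      forall x, der0 alpha x = p0 (der0 (sg_val D) (s0 x))
    & forall a, der1 alpha a = p1 (der1 (sg_val D) (s1 a))].

Definition is_wells_map (W : Drho -> H2) : Prop := forall ba : Drho,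
  exists c : Z2, sg_val c = wells_cochain (sg_val ba) (ext_cocycle s) /\
                 W ba = H2_class c.

End Groups.

Definition exact_at (A B C : zmodType) (f : A -> B) (g : B -> C) : Prop :=
  forall b, g b = 0 <-> exists a, f a = b.

End CrossedModules.

(* Main.v *)
(* In the coordinates (x, u) |-> s x + u of the extension, a derivation D that
   preserves V is lower triangular: D (x, u) = (alpha x, h x + beta u), where
   beta = D|V, alpha is the induced map on p and h is a 1-cochain.  Conversely,
   such a map is a derivation exactly when (beta, alpha) is compatible with rho
   and Psi(beta, alpha)(c) = coboundary h.  Taking beta = alpha = 0 gives
   exactness at Der_V, and letting h vary gives exactness at D_rho. *)
Require Import Defs.
From HB Require Import structures.
From mathcomp Require Import all_boot all_order all_algebra.
From mathcomp Require Import boolp.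
Import GRing.Theory.
Local Open Scope ring_scope.

Set Implicit Arguments.
Unset Strict Implicit.
Unset Printing Implicit Defensive.

(** * Derivations as pairs of linear maps *)

Section Derivations.
Variables (F : fieldType) (C : crossed_module F) (D : Der C).

(** Stated for the rebuilt pair, so that the two components receive linear instances and the generic
    linearity lemmas rewrite under them. *)
Lemma derP : is_derivation (der0 D, der1 D).
Proof. by have := sg_typeP D; rewrite /der0 /der1; case: (sg_val D). Qed.

HB.instance Definition _ :=
  GRing.isLinear.Build F (cm0 C) (cm0 C) *:%R (der0 D) (der_lin0 derP).
HB.instance Definition _ :=
  GRing.isLinear.Build F (cm1 C) (cm1 C) *:%R (der1 D) (der_lin1 derP).

End Derivations.

Lemma derE (F : fieldType) (C : crossed_module F) (D D' : Der C) :
  der0 D =1 der0 D' -> der1 D =1 der1 D' -> D = D'.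
Proof.
move=> e0 e1; apply: val_inj => /=.
rewrite [LHS]surjective_pairing [RHS]surjective_pairing.
by congr (_, _); apply/funext.
Qed.

Lemma der0_sub (F : fieldType) (C : crossed_module F) (D D' : Der C) x :
  der0 (D - D') x = der0 D x - der0 D' x.
Proof. by rewrite /der0 raddfB. Qed.

Lemma der1_sub (F : fieldType) (C : crossed_module F) (D D' : Der C) x :
  der1 (D - D') x = der1 D x - der1 D' x.
Proof. by rewrite /der1 raddfB. Qed.

Lemma der0_zero (F : fieldType) (C : crossed_module F) x :
  der0 (0 : Der C) x = 0.
Proof. by rewrite /der0 raddf0. Qed.

Lemma der1_zero (F : fieldType) (C : crossed_module F) x :
  der1 (0 : Der C) x = 0.
Proof. by rewrite /der1 raddf0. Qed.

(** * Rearrangements of sums in an abelian group *)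

Lemma subr2_eq (M : zmodType) (A B L H : M) :
  A - B = L - H <-> H + A = B + L.
Proof.
split=> [/(congr1 (fun z => H + (B + z)))|/(congr1 (fun z => z - H - B))].
  by rewrite [B + _]addrC subrK => ->; rewrite addrC addrA subrK.
by rewrite [H + A]addrC addrK [B + L]addrC addrAC addrK.
Qed.

Lemma subr3_eq (M : zmodType) (A B C L R H : M) :
  A - B - C = L + R - H <-> H + A = B + R + (C + L).
Proof.
by rewrite -[A - B - C]addrA -opprD subr2_eq [L + R]addrC addrACA.
Qed.

(* Shape of the V-component of D [x + u, y + v] = [D (x + u), y + v]
   + [x + u, D (y + v)]: the first hypothesis is its part independent of u and
   v, the others are the parts in v and in u. *)
Lemma der_sum_eq (M : zmodType) (H W A R B L X Y Z T Q S : M) :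
  H + W = A + R + (B + L) -> X = Y + Z -> T = Q + S ->
  H + (W + X + T) = A + Y + (R + S) + (B + (L + Z) + Q).
Proof.
move=> e -> ->; rewrite !addrA e !addrA.
by rewrite [LHS](ACl (1*5*2*8*3*4*6*7)).
Qed.

(** Partial converse of [der_sum_eq]: subtracting the part free of [u] and [v] isolates the part in
    [v]. [der_sum_cancel2] does the same for the part in [u]. *)
Lemma der_sum_cancel1 (M : zmodType) (H W A R B L X Y Z : M) :
  H + W = A + R + (B + L) -> H + (W + X) = A + Y + R + (B + (L + Z)) ->
  X = Y + Z.
Proof.
move=> e; rewrite addrA e => e'; apply: (@addrI _ (A + R + (B + L))).
by rewrite e' !addrA [LHS](ACl (1*3*4*5*2*6)).
Qed.

Lemma der_sum_cancel2 (M : zmodType) (H W A R B L X Y Z : M) :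
  H + W = A + R + (B + L) -> H + (W + X) = A + (R + Z) + (B + L + Y) ->
  X = Y + Z.
Proof.
move=> e; rewrite addrA e => e'; apply: (@addrI _ (A + R + (B + L))).
by rewrite e' !addrA [LHS](ACl (1*2*4*5*6*3)).
Qed.

(** For a cocycle equation in three arguments: the first hypothesis is its image under beta, the
    other three substitute alpha in one argument each. *)
Lemma eq_sub4 (M : zmodType) (L R A0 A1 A2 A3 C0 C1 C2 C3 : M) :
  A0 = C0 -> A1 = C1 -> A2 = C2 -> A3 = C3 ->
  L = A0 - A1 - A2 - A3 -> R = C0 - C1 - C2 - C3 -> L = R.
Proof. by move=> -> -> -> -> -> ->. Qed.

Lemma eq_sub3 (M : zmodType) (L R A0 A1 A2 C0 C1 C2 : M) :
  A0 = C0 -> A1 = C1 -> A2 = C2 ->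
  L = A0 - A1 - A2 -> R = C0 - C1 - C2 -> L = R.
Proof. by move=> -> -> -> -> ->. Qed.

(** Components of a cochain are bare functions with linearity as a hypothesis, so [linearD] does not
    apply to them. *)
Lemma linear_add (F : fieldType) (U W : lmodType F) (f : U -> W) :
  linear f -> {morph f : x y / x + y}.
Proof. by move=> lf x y; have := lf 1 x y; rewrite !scale1r. Qed.

(** * Coordinates on the extension and lower triangular maps *)

Section Lift.
Variables (F : fieldType) (V P : crossed_module F).
Variables (E : abelian_extension V P) (s : ext_section E).

Local Notation hat := (ext_tot E).
Local Notation inc0 := (hom0 (ext_inc E)).
Local Notation inc1 := (hom1 (ext_inc E)).
Local Notation p0 := (hom0 (ext_proj E)).
Local Notation p1 := (hom1 (ext_proj E)).
Local Notation s0 := (sec0 s).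
Local Notation s1 := (sec1 s).
Local Notation c := (ext_cocycle s).

Definition join0 (x : cm0 P) (u : cm0 V) : cm0 hat := s0 x + inc0 u.
Definition join1 (a : cm1 P) (m : cm1 V) : cm1 hat := s1 a + inc1 m.

Lemma proj_join0 x u : p0 (join0 x u) = x.
Proof. by rewrite linearD /= sec0K proj_inc0 addr0. Qed.
Lemma proj_join1 a m : p1 (join1 a m) = a.
Proof. by rewrite linearD /= sec1K proj_inc1 addr0. Qed.

Lemma join0_inj x u y v : join0 x u = join0 y v -> x = y /\ u = v.
Proof.
move=> e; have exy : x = y by rewrite -(proj_join0 x u) e proj_join0.
by split=> //; move: e; rewrite exy => /addrI /(@ext_inc0_inj _ _ _ E).
Qed.
Lemma join1_inj a m b n : join1 a m = join1 b n -> a = b /\ m = n.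
Proof.
move=> e; have eab : a = b by rewrite -(proj_join1 a m) e proj_join1.
by split=> //; move: e; rewrite eab => /addrI /(@ext_inc1_inj _ _ _ E).
Qed.

Lemma join0_linear k x u y v :
  k *: join0 x u + join0 y v = join0 (k *: x + y) (k *: u + v).
Proof. by rewrite /join0 !linearP scalerDr addrACA. Qed.
Lemma join1_linear k a m b n :
  k *: join1 a m + join1 b n = join1 (k *: a + b) (k *: m + n).
Proof. by rewrite /join1 !linearP scalerDr addrACA. Qed.

Lemma join0D x u y v : join0 x u + join0 y v = join0 (x + y) (u + v).
Proof. by rewrite /join0 !linearD addrACA. Qed.
Lemma join1D a m b n : join1 a m + join1 b n = join1 (a + b) (m + n).
Proof. by rewrite /join1 !linearD addrACA. Qed.

Lemma join0x0 x : join0 x 0 = s0 x.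
Proof. by rewrite /join0 linear0 addr0. Qed.
Lemma join00x u : join0 0 u = inc0 u.
Proof. by rewrite /join0 linear0 add0r. Qed.
Lemma join1x0 a : join1 a 0 = s1 a.
Proof. by rewrite /join1 linear0 addr0. Qed.
Lemma join10x m : join1 0 m = inc1 m.
Proof. by rewrite /join1 linear0 add0r. Qed.

(** The V-coordinate. The argument of [pull] lies in the kernel of the projection, hence in the
    image of V, so the default value never occurs. *)
Definition ret0 (y : cm0 hat) : cm0 V := pull inc0 (y - s0 (p0 y)).
Definition ret1 (b : cm1 hat) : cm1 V := pull inc1 (b - s1 (p1 b)).

Lemma join0K y : join0 (p0 y) (ret0 y) = y.
Proof.
by rewrite /join0 pull0P ?(addrC (s0 _)) ?subrK // linearB /= sec0K subrr.
Qed.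
Lemma join1K b : join1 (p1 b) (ret1 b) = b.
Proof.
by rewrite /join1 pull1P ?(addrC (s1 _)) ?subrK // linearB /= sec1K subrr.
Qed.

Lemma ret_join0 x u : ret0 (join0 x u) = u.
Proof. by have /join0_inj [] := join0K (join0 x u). Qed.
Lemma ret_join1 a m : ret1 (join1 a m) = m.
Proof. by have /join1_inj [] := join1K (join1 a m). Qed.

(** With the next three lemmas: in coordinates the extension is the structure twisted by its own
    cocycle, as in [twist_f] and [twist_br]. Brackets of two elements of V drop out because V is
    abelian. *)
Lemma f_join a m : cmf (join1 a m) = join0 (cmf a) (cth c a + cmf m).
Proof. by rewrite linearD /= f_sec -hom_f /join0 linearD addrA. Qed.
Lemma br_join x u y v : cmbr (join0 x u) (join0 y v) =
  join0 (cmbr x y) (com c x y + l00 s x v + r00 s y u).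
Proof.
have abr := abelian_br (abext_abelian E).
rewrite linearDl !linearDr /= br_sec -hom_br abr linear0 addr0.
by rewrite -inc_l00 -inc_r00 /join0 !linearD !addrA.
Qed.
Lemma la_join x u a m : cmla (join0 x u) (join1 a m) =
  join1 (cmla x a) (cmu c x a + l01 s x m + r1 s a u).
Proof.
have ala := abelian_la (abext_abelian E).
rewrite linearDl !linearDr /= la_sec -hom_la ala linear0 addr0.
by rewrite -inc_l01 -inc_r1 /join1 !linearD !addrA.
Qed.
Lemma ra_join a m x u : cmra (join1 a m) (join0 x u) =
  join1 (cmra a x) (cnu c a x + l1 s a u + r01 s x m).
Proof.
have ara := abelian_ra (abext_abelian E).
have := ra_sec s x a; move: (cnu c a x) => n raE.
rewrite linearDl !linearDr /= raE -hom_ra ara linear0 addr0.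
by rewrite -inc_l1 -inc_r01 /join1 !linearD !addrA.
Qed.

Definition lift_map (ba : Der V * Der P) (h : cochain1 V P) :
    (cm0 hat -> cm0 hat) * (cm1 hat -> cm1 hat) :=
  (fun y => join0 (der0 ba.2 (p0 y)) (h.1 (p0 y) + der0 ba.1 (ret0 y)),
   fun b => join1 (der1 ba.2 (p1 b)) (h.2 (p1 b) + der1 ba.1 (ret1 b))).

(** The equation Psi(beta, alpha)(c) = coboundary h without subtractions, which is the form that
    comes out of the derivation identities. *)
Record wells_eqs (ba : Der V * Der P) (h : cochain1 V P) : Prop := WellsEqs {
  weq_th : forall a, h.1 (cmf a) + der0 ba.1 (cth c a) =
    cth c (der1 ba.2 a) + cmf (h.2 a);
  weq_om : forall x y, h.1 (cmbr x y) + der0 ba.1 (com c x y) =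
    com c (der0 ba.2 x) y + r00 s y (h.1 x)
    + (com c x (der0 ba.2 y) + l00 s x (h.1 y));
  weq_mu : forall x a, h.2 (cmla x a) + der1 ba.1 (cmu c x a) =
    cmu c (der0 ba.2 x) a + r1 s a (h.1 x)
    + (cmu c x (der1 ba.2 a) + l01 s x (h.2 a));
  weq_nu : forall a x, h.2 (cmra a x) + der1 ba.1 (cnu c a x) =
    cnu c (der1 ba.2 a) x + r01 s x (h.2 a)
    + (cnu c a (der0 ba.2 x) + l1 s a (h.1 x)) }.

Lemma wells_eqsP ba h :
  wells_cochain ba c = coboundary s h <-> wells_eqs ba h.
Proof.
split=> [e|[eth eom emu enu]].
  split.
  - by move=> a; apply/subr2_eq; have := congr1 (fun d => cth d a) e.
  - by move=> x y; apply/subr3_eq; have := congr1 (fun d => com d x y) e.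
  - by move=> x a; apply/subr3_eq; have := congr1 (fun d => cmu d x a) e.
  - by move=> a x; apply/subr3_eq; have := congr1 (fun d => cnu d a x) e.
apply: cochain2P => [a|x y|x a|a x].
- exact/subr2_eq/eth.
- exact/subr3_eq/eom.
- exact/subr3_eq/emu.
- exact/subr3_eq/enu.
Qed.

Lemma lift_map_join0 ba h x u :
  (lift_map ba h).1 (join0 x u) = join0 (der0 ba.2 x) (h.1 x + der0 ba.1 u).
Proof. by rewrite /lift_map /= proj_join0 ret_join0. Qed.
Lemma lift_map_join1 ba h a m :
  (lift_map ba h).2 (join1 a m) = join1 (der1 ba.2 a) (h.2 a + der1 ba.1 m).
Proof. by rewrite /lift_map /= proj_join1 ret_join1. Qed.

(** The P-coordinate of each derivation identity holds because alpha is a derivation. The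
    V-coordinate splits into a part free of V-arguments, which is [wells_eqs], and parts linear in
    one V-argument, which give [rho_compatible], or for f the fact that beta commutes with it. *)
Lemma is_derivation_lift_map ba h : is_cochain1 h ->
  is_derivation (lift_map ba h) <-> rho_compatible s ba /\ wells_eqs ba h.
Proof.
move=> [lh0 lh1].
have [bf af] := (der_f (derP ba.1), der_f (derP ba.2)).
have abr := der_br (derP ba.2).
have ala := der_la (derP ba.2).
have ara := der_ra (derP ba.2).
rewrite /= in bf af abr ala ara.
split=> [[_ _ df dbr dla dra]|
  [[cl00 cr00 cl01 cr01 cl1 cr1] [eth eom emu enu]]].
  (* Each identity is evaluated in coordinates, and only its V-coordinate is kept. *)
  have {}df a m : h.1 (cmf a) + der0 ba.1 (cth c a + cmf m) =
      cth c (der1 ba.2 a) + cmf (h.2 a + der1 ba.1 m).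
    have := df (join1 a m).
    by rewrite f_join lift_map_join0 lift_map_join1 f_join => /join0_inj [].
  have {}dbr x u y v :
      h.1 (cmbr x y) + der0 ba.1 (com c x y + l00 s x v + r00 s y u) =
      com c (der0 ba.2 x) y + l00 s (der0 ba.2 x) v
      + r00 s y (h.1 x + der0 ba.1 u)
      + (com c x (der0 ba.2 y) + l00 s x (h.1 y + der0 ba.1 v)
         + r00 s (der0 ba.2 y) u).
    have := dbr (join0 x u) (join0 y v).
    by rewrite !(br_join, lift_map_join0) join0D => /join0_inj [].
  have {}dla x u a m :
      h.2 (cmla x a) + der1 ba.1 (cmu c x a + l01 s x m + r1 s a u) =
      cmu c (der0 ba.2 x) a + l01 s (der0 ba.2 x) m
      + r1 s a (h.1 x + der0 ba.1 u)
      + (cmu c x (der1 ba.2 a) + l01 s x (h.2 a + der1 ba.1 m)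
         + r1 s (der1 ba.2 a) u).
    have := dla (join0 x u) (join1 a m).
    rewrite !(la_join, lift_map_join0, lift_map_join1) join1D.
    by case/join1_inj.
  have {}dra a m x u :
      h.2 (cmra a x) + der1 ba.1 (cnu c a x + l1 s a u + r01 s x m) =
      cnu c (der1 ba.2 a) x + l1 s (der1 ba.2 a) u
      + r01 s x (h.2 a + der1 ba.1 m)
      + (cnu c a (der0 ba.2 x) + l1 s a (h.1 x + der0 ba.1 u)
         + r01 s (der0 ba.2 x) m).
    have := dra (join1 a m) (join0 x u).
    rewrite !(ra_join, lift_map_join0, lift_map_join1) join1D.
    by case/join1_inj.
  (* Setting all V-arguments to 0 leaves the Wells equations. *)
  have eth a : h.1 (cmf a) + der0 ba.1 (cth c a) =
      cth c (der1 ba.2 a) + cmf (h.2 a).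
    by have := df a 0; rewrite !(linear0, addr0).
  have eom x y : h.1 (cmbr x y) + der0 ba.1 (com c x y) =
      com c (der0 ba.2 x) y + r00 s y (h.1 x)
      + (com c x (der0 ba.2 y) + l00 s x (h.1 y)).
    by have := dbr x 0 y 0; rewrite !(linear0, linear0r, addr0).
  have emu x a : h.2 (cmla x a) + der1 ba.1 (cmu c x a) =
      cmu c (der0 ba.2 x) a + r1 s a (h.1 x)
      + (cmu c x (der1 ba.2 a) + l01 s x (h.2 a)).
    by have := dla x 0 a 0; rewrite !(linear0, linear0r, addr0).
  have enu a x : h.2 (cmra a x) + der1 ba.1 (cnu c a x) =
      cnu c (der1 ba.2 a) x + r01 s x (h.2 a)
      + (cnu c a (der0 ba.2 x) + l1 s a (h.1 x)).
    by have := dra a 0 x 0; rewrite !(linear0, linear0r, addr0).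
  split; split=> //.
  (* A pure P-argument against a pure V-argument isolates a single action; the Wells equation with
     one argument 0 is subtracted. *)
  - move=> x v; apply: der_sum_cancel1 (eom x 0) _; have := dbr x 0 0 v.
    by rewrite !(linear0, linear0r, addr0, linearD, linearDr).
  - move=> x v; apply: der_sum_cancel2 (eom 0 x) _; have := dbr 0 v x 0.
    by rewrite !(linear0, linear0r, addr0, linearD, linearDr).
  - move=> x m; apply: der_sum_cancel1 (emu x 0) _; have := dla x 0 0 m.
    by rewrite !(linear0, linear0r, addr0, linearD, linearDr).
  - move=> x m; apply: der_sum_cancel2 (enu 0 x) _; have := dra 0 m x 0.
    by rewrite !(linear0, linear0r, addr0, linearD, linearDr).
  - move=> a v; apply: der_sum_cancel1 (enu a 0) _; have := dra a 0 0 v.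
    by rewrite !(linear0, linear0r, addr0, linearD, linearDr).
  - move=> a v; apply: der_sum_cancel2 (emu 0 a) _; have := dla 0 v a 0.
    by rewrite !(linear0, linear0r, addr0, linearD, linearDr).
split.
(* Conversely, every element has coordinates, so each identity is checked on them, and for brackets
   the V-parts recombine by [der_sum_eq]. *)
- move=> k y z; rewrite -(join0K y) -(join0K z) join0_linear !lift_map_join0.
  rewrite join0_linear lh0 !linearP; congr (join0 _ _).
  by rewrite /= scalerDr addrACA.
- move=> k y z; rewrite -(join1K y) -(join1K z) join1_linear !lift_map_join1.
  rewrite join1_linear lh1 !linearP; congr (join1 _ _).
  by rewrite /= scalerDr addrACA.
- move=> b; rewrite -(join1K b) f_join lift_map_join0 lift_map_join1 f_join.
  by rewrite !linearD /= addrA eth af bf addrA.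
- move=> y z; rewrite -(join0K y) -(join0K z) !(br_join, lift_map_join0) join0D.
  congr (join0 _ _) => //; rewrite !(linearD, linearDr) /=.
  exact: der_sum_eq.
- move=> y b; rewrite -(join0K y) -(join1K b).
  rewrite !(la_join, lift_map_join0, lift_map_join1) join1D.
  congr (join1 _ _) => //; rewrite !(linearD, linearDr) /=.
  exact: der_sum_eq.
- move=> b y; rewrite -(join0K y) -(join1K b).
  rewrite !(ra_join, lift_map_join0, lift_map_join1) join1D.
  congr (join1 _ _) => //; rewrite !(linearD, linearDr) /=.
  exact: der_sum_eq.
Qed.

End Lift.

(** * The Wells cochain of a cocycle is a cocycle *)

Section WellsCocycle.
Variables (F : fieldType) (V P : crossed_module F).
Variables (E : abelian_extension V P) (s : ext_section E).
Variables (ba : Der V * Der P) (c : cochain2 V P).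
Hypotheses (bac : rho_compatible s ba) (ch : is_cochain2 c).

Local Notation b0 := (der0 ba.1).
Local Notation b1 := (der1 ba.1).
Local Notation a0 := (der0 ba.2).
Local Notation a1 := (der1 ba.2).
Local Notation w := (wells_cochain ba c).

Lemma is_cochain2_wells : is_cochain2 w.
Proof.
have [lth [oml omr] [mul mur] [nul nur]] := ch.
have sub2 (M N : lmodType F) (f g : M -> N) (b : {linear N -> N}) :
  linear f -> linear g -> linear (fun x => b (f x) - g x).
  by move=> lf lg k u v; rewrite lf lg linearP scalerBr opprD addrACA.
have sub3 (M N : lmodType F) (f g h : M -> N) (b : {linear N -> N}) :
  linear f -> linear g -> linear h -> linear (fun x => b (f x) - g x - h x).
  move=> lf lg lh k u v; rewrite sub2 // lh.
  by rewrite (scalerBr k (_ - _)) opprD addrACA.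
have comp (M M' N : lmodType F) (f : M' -> N) (b : {linear M -> M'}) :
  linear f -> linear (f \o b).
  by move=> lf k u v; rewrite /= linearP lf.
split.
- by apply: sub2 => //; apply: (comp _ _ _ _ a1).
- split=> [x|y].
    by apply: sub3 => //; apply: (comp _ _ _ _ a0).
  by apply: sub3 => //; apply: (comp _ _ _ (com c ^~ y) a0).
- split=> [x|a].
    by apply: sub3 => //; apply: (comp _ _ _ _ a1).
  by apply: sub3 => //; apply: (comp _ _ _ (cmu c ^~ a) a0).
- split=> [a|x].
    by apply: sub3 => //; apply: (comp _ _ _ _ a0).
  by apply: sub3 => //; apply: (comp _ _ _ (cnu c ^~ x) a1).
Qed.

Lemma cth_wells a : cth w a = b0 (cth c a) - cth c (a1 a).
Proof. by []. Qed.
Lemma com_wells x y :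
  com w x y = b0 (com c x y) - com c (a0 x) y - com c x (a0 y).
Proof. by []. Qed.
Lemma cmu_wells x a :
  cmu w x a = b1 (cmu c x a) - cmu c (a0 x) a - cmu c x (a1 a).
Proof. by []. Qed.
Lemma cnu_wells a x :
  cnu w a x = b1 (cnu c a x) - cnu c (a1 a) x - cnu c a (a0 x).
Proof. by []. Qed.

(* Each equation for w is beta applied to that equation for c, minus the
   equations for c obtained by applying alpha to one of the arguments. *)
Lemma cocycle_eqs_wells : cocycle_eqs s c -> cocycle_eqs s w.
Proof.
move=> ce.
have [lth [oml omr] [mul mur] [nul nur]] := ch.
have thD := linear_add lth.
have omlD x := linear_add (oml x); have omrD y := linear_add (omr y).
have mulD x := linear_add (mul x); have murD y := linear_add (mur y).
have nulD x := linear_add (nul x); have nurD y := linear_add (nur y).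
have cD := (thD, (omlD, omrD), (mulD, murD), (nulD, nurD)).
rewrite /= in cD.
have [_ _ /= af abr ala ara] := derP ba.2.
have /= bf := der_f (derP ba.1).
have dE := (abr, ala, ara).
have [rl00 rr00 rl01 rr01 rl1 rr1] := bac.
(* Compatibility is solved for the term in which beta acts first, so that rewriting moves beta
   outside the actions. *)
have subE (M : zmodType) (X Y Z : M) : X = Y + Z -> Z = X - Y.
  by move=> ->; rewrite addrC addKr.
have rE := (fun x v => subE _ _ _ _ (rl00 x v),
  fun x v => subE _ _ _ _ (rr00 x v), fun x m => subE _ _ _ _ (rl01 x m),
  fun x m => subE _ _ _ _ (rr01 x m), fun a v => subE _ _ _ _ (rl1 a v),
  fun a v => subE _ _ _ _ (rr1 a v)).
have wE := (com_wells, cmu_wells, cnu_wells, cth_wells).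
split.
- move=> x y z.
  (* The two goals left, one for each side of the equation, hold up to the order of the summands. *)
  apply: (eq_sub4 (congr1 b0 (ceq_leibniz ce x y z)) (ceq_leibniz ce (a0 x) y z)
    (ceq_leibniz ce x (a0 y) z) (ceq_leibniz ce x y (a0 z)));
    rewrite !wE ?(linearBr, linearDr, linearB, linearD) /= !rE !dE !cD;
    rewrite ?opprD ?opprK ?addrA.
  by rewrite [LHS](ACl (1*5*2*6*3*7*4*8)).
  by rewrite [LHS](ACl (1*5*9*13*2*7*11*15*3*8*10*14*4*6*12*16)).
- move=> x y a.
  apply: (eq_sub4 (congr1 b1 (ceq_la_br ce x y a)) (ceq_la_br ce (a0 x) y a)
    (ceq_la_br ce x (a0 y) a) (ceq_la_br ce x y (a1 a)));
    rewrite !wE ?(linearBr, linearDr, linearB, linearD) /= !rE !dE !cD;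
    rewrite ?opprD ?opprK ?addrA.
  by rewrite [LHS](ACl (1*5*2*7*3*8*4*6)).
  by rewrite [LHS](ACl (1*5*9*13*2*6*11*15*3*7*10*14*4*8*12*16)).
- move=> x y a.
  apply: (eq_sub4 (congr1 b1 (ceq_ra_br ce x y a)) (ceq_ra_br ce (a0 x) y a)
    (ceq_ra_br ce x (a0 y) a) (ceq_ra_br ce x y (a1 a)));
    rewrite !wE ?(linearBr, linearDr, linearB, linearD) /= !rE !dE !cD;
    rewrite ?opprD ?opprK ?addrA.
  by rewrite [LHS](ACl (1*5*3*7*4*8*2*6)).
  by rewrite [LHS](ACl (1*5*9*13*3*8*10*14*4*6*12*16*2*7*11*15)).
- move=> x y a.
  apply: (eq_sub4 (congr1 b1 (ceq_la_ra ce x y a)) (ceq_la_ra ce (a0 x) y a)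
    (ceq_la_ra ce x (a0 y) a) (ceq_la_ra ce x y (a1 a)));
    rewrite !wE ?(linearBr, linearDr, linearB, linearD) /= !rE !dE !cD;
    rewrite ?opprD ?opprK ?addrA.
  by rewrite [LHS](ACl (1*5*3*7*4*8*2*6)).
  by rewrite [LHS](ACl (1*5*9*13*2*6*10*15*4*8*12*14*3*7*11*16)).
- move=> x a.
  (* Two arguments give two substitutions of alpha; [bf] and [af] carry beta and alpha across f. *)
  apply: (eq_sub3 (congr1 b0 (ceq_f_la ce x a)) (ceq_f_la ce (a0 x) a)
    (ceq_f_la ce x (a1 a)));
    rewrite !wE ?(linearBr, linearDr, linearB, linearD) /= ?rE ?dE ?cD ?bf ?af;
    rewrite ?opprD ?opprK ?addrA.
  by rewrite [LHS](ACl (1*4*2*5*3*6)).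
  by rewrite [LHS](ACl (1*4*2*5*3*6)).
- move=> x a.
  apply: (eq_sub3 (congr1 b0 (ceq_f_ra ce x a)) (ceq_f_ra ce (a0 x) a)
    (ceq_f_ra ce x (a1 a)));
    rewrite !wE ?(linearBr, linearDr, linearB, linearD) /= ?rE ?dE ?cD ?bf ?af;
    rewrite ?opprD ?opprK ?addrA.
  by rewrite [LHS](ACl (1*4*3*6*2*5)).
  by rewrite [LHS](ACl (1*4*3*5*2*6)).
- move=> a b.
  apply: (eq_sub3 (congr1 b1 (ceq_peiffer ce a b)) (ceq_peiffer ce (a1 a) b)
    (ceq_peiffer ce a (a1 b)));
    rewrite !wE ?(linearBr, linearDr, linearB, linearD) /= ?rE ?dE ?cD ?bf ?af;
    rewrite ?opprD ?opprK ?addrA.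
  by rewrite [LHS](ACl (1*4*2*6*3*5)).
  by rewrite [LHS](ACl (1*4*2*5*3*6)).
Qed.

End WellsCocycle.

Lemma is_cocycle2_wells (F : fieldType) (V P : crossed_module F)
    (E : abelian_extension V P) (s : ext_section E) (ba : Der V * Der P)
    (c : cochain2 V P) :
  rho_compatible s ba -> is_cocycle2 s c -> is_cocycle2 s (wells_cochain ba c).
Proof.
move=> bac cc; have [ch _] := cc.
apply: cocycle_eqs_is; first exact: is_cochain2_wells.
exact/cocycle_eqs_wells/is_cocycle2_eqs.
Qed.

(** Each summand contains beta or alpha exactly once; for alpha, additivity comes from the linearity
    of c in that argument. *)
Lemma wells_cochainB (F : fieldType) (V P : crossed_module F)
    (ba ba' : Der V * Der P) (c : cochain2 V P) : is_cochain2 c ->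
  wells_cochain (ba - ba') c = wells_cochain ba c - wells_cochain ba' c.
Proof.
move=> [lth [oml omr] [mul mur] [nul nur]].
have sub2 (M : zmodType) (a b a' b' : M) :
    a - b - (a' - b') = a - a' - (b - b').
  by rewrite !opprD !opprK addrACA.
have sub3 (M : zmodType) (a b d a' b' d' : M) :
    a - b - d - (a' - b' - d') = a - a' - (b - b') - (d - d').
  by rewrite sub2 (sub2 _ a).
apply: cochain2P => [a|x y|x a|a x].
- rewrite cthB [RHS]sub2 !cth_wells /= der0_sub der1_sub.
  by rewrite (zmod_morphism_linear lth).
- rewrite comB [RHS]sub3 !com_wells /= !der0_sub.
  by rewrite (zmod_morphism_linear (oml _)) (zmod_morphism_linear (omr _)).
- rewrite cmuB [RHS]sub3 !cmu_wells /= der0_sub !der1_sub.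
  by rewrite (zmod_morphism_linear (mul _)) (zmod_morphism_linear (mur _)).
- rewrite cnuB [RHS]sub3 !cnu_wells /= der0_sub !der1_sub.
  by rewrite (zmod_morphism_linear (nul _)) (zmod_morphism_linear (nur _)).
Qed.

(** * The maps of the Wells sequence and its exactness *)

Section WellsSequence.
Variables (F : fieldType) (V P : crossed_module F).
Variables (E : abelian_extension V P) (s : ext_section E).

Local Notation hat := (ext_tot E).
Local Notation inc0 := (hom0 (ext_inc E)).
Local Notation inc1 := (hom1 (ext_inc E)).
Local Notation p0 := (hom0 (ext_proj E)).
Local Notation p1 := (hom1 (ext_proj E)).
Local Notation s0 := (sec0 s).
Local Notation s1 := (sec1 s).
Local Notation c := (ext_cocycle s).

(** [pull] is a choice of preimage; linearity comes from the uniqueness of coordinates. *)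
Lemma ret0_linear : linear (ret0 s).
Proof.
move=> k y z; have := join0K s (k *: y + z).
rewrite -[in RHS](join0K s y) -[in RHS](join0K s z) join0_linear.
by case/join0_inj.
Qed.
Lemma ret1_linear : linear (ret1 s).
Proof.
move=> k y z; have := join1K s (k *: y + z).
rewrite -[in RHS](join1K s y) -[in RHS](join1K s z) join1_linear.
by case/join1_inj.
Qed.

(** * Diagonal and corner entries of a derivation preserving V *)

Section Restriction.
Variable D : DerV E.
Let d := sg_val D.
Let d0 := der0 d.
Let d1 := der1 d.

Definition subder0 (v : cm0 V) : cm0 V := pull inc0 (d0 (inc0 v)).
Definition subder1 (m : cm1 V) : cm1 V := pull inc1 (d1 (inc1 m)).
Definition quoder0 (x : cm0 P) : cm0 P := p0 (d0 (s0 x)).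
Definition quoder1 (a : cm1 P) : cm1 P := p1 (d1 (s1 a)).
(** The corner entry h of the triangular form of D. *)
Definition mixder : cochain1 V P :=
  (fun x => ret0 s (d0 (s0 x)), fun a => ret1 s (d1 (s1 a))).

Lemma inc_subder0 v : inc0 (subder0 v) = d0 (inc0 v).
Proof.
have [/(_ v) [v' e] _] := sg_typeP D.
by rewrite /subder0 pullP //; exists v'; rewrite -e.
Qed.
Lemma inc_subder1 m : inc1 (subder1 m) = d1 (inc1 m).
Proof.
have [_ /(_ m) [m' e]] := sg_typeP D.
by rewrite /subder1 pullP //; exists m'; rewrite -e.
Qed.

(** Since D preserves V, the induced map may be computed from any lift, not only from the
    section. *)
Lemma proj_der0 y : p0 (d0 y) = quoder0 (p0 y).
Proof.
rewrite -[in LHS](join0K s y) /join0 /d0 !linearD /= -/d0.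
by rewrite -inc_subder0 proj_inc0 addr0.
Qed.
Lemma proj_der1 b : p1 (d1 b) = quoder1 (p1 b).
Proof.
rewrite -[in LHS](join1K s b) /join1 /d1 !linearD /= -/d1.
by rewrite -inc_subder1 proj_inc1 addr0.
Qed.

Lemma is_derivation_sub : is_derivation (subder0, subder1).
Proof.
have [/= l0 l1 df dbr dla dra] := derP d.
split=> /= [k u v|k m n|m|u v|u m|m u].
- apply: (@ext_inc0_inj _ _ _ E).
  by rewrite linearP !inc_subder0 linearP /d0 linearP.
- apply: (@ext_inc1_inj _ _ _ E).
  by rewrite linearP !inc_subder1 linearP /d1 linearP.
- apply: (@ext_inc0_inj _ _ _ E).
  by rewrite inc_subder0 !hom_f inc_subder1 /d0 df.
- apply: (@ext_inc0_inj _ _ _ E).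
  by rewrite inc_subder0 linearD !hom_br !inc_subder0 /d0 dbr.
- apply: (@ext_inc1_inj _ _ _ E).
  by rewrite inc_subder1 linearD !hom_la inc_subder0 inc_subder1 /d1 dla.
- apply: (@ext_inc1_inj _ _ _ E).
  by rewrite inc_subder1 linearD !hom_ra inc_subder0 inc_subder1 /d1 dra.
Qed.

(** A bracket of sections lifts the bracket in P, so by [proj_der0] the identities of D project to
    P. *)
Lemma is_derivation_quo : is_derivation (quoder0, quoder1).
Proof.
have [/= l0 l1 df dbr dla dra] := derP d.
split=> /= [k x y|k a b|a|x y|x a|a x].
- by rewrite /quoder0 /d0 !linearP.
- by rewrite /quoder1 /d1 !linearP.
- by rewrite -{1}(sec1K s a) -hom_f -proj_der0 /d0 df hom_f.
- rewrite -{1}(sec0K s x) -{1}(sec0K s y) -hom_br -proj_der0 /d0 dbr.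
  by rewrite linearD !hom_br !sec0K.
- rewrite -{1}(sec0K s x) -{1}(sec1K s a) -hom_la -proj_der1 /d1 dla.
  by rewrite linearD !hom_la sec0K sec1K.
- rewrite -{1}(sec0K s x) -{1}(sec1K s a) -hom_ra -proj_der1 /d1 dra.
  by rewrite linearD !hom_ra sec0K sec1K.
Qed.

Lemma is_cochain1_mix : is_cochain1 mixder.
Proof.
split=> k x y; rewrite /= linearP.
  by rewrite -ret0_linear /d0 linearP.
by rewrite -ret1_linear /d1 linearP.
Qed.

Definition der_pair : Der V * Der P :=
  (sg_elt (G := der_subgroup V) is_derivation_sub,
   sg_elt (G := der_subgroup P) is_derivation_quo).

Lemma lift_map_der_pair : lift_map s der_pair mixder = (d0, d1).
Proof.
congr (_, _); [apply/funext => y|apply/funext => b].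
  rewrite -[in RHS](join0K s y) /d0 [in RHS]/join0 linearD /= -/d0.
  rewrite -inc_subder0 /join0 linearD addrA; congr (_ + _).
  exact: (join0K s (d0 (s0 (p0 y)))).
rewrite -[in RHS](join1K s b) /d1 [in RHS]/join1 linearD /= -/d1.
rewrite -inc_subder1 /join1 linearD addrA; congr (_ + _).
exact: (join1K s (d1 (s1 (p1 b)))).
Qed.

(** The triangular criterion applied to D itself: the first half makes Phi land in D_rho, the second
    makes the Wells class of Phi(D) vanish. *)
Lemma der_pair_eqs : rho_compatible s der_pair /\ wells_eqs s der_pair mixder.
Proof.
apply/(is_derivation_lift_map _ _ is_cochain1_mix); rewrite lift_map_der_pair.
exact: derP.
Qed.

Definition restriction : Drho s :=
  sg_elt (G := Drho_subgroup s) der_pair_eqs.1.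

End Restriction.

Lemma der_pairB D D' : der_pair (D - D') = der_pair D - der_pair D'.
Proof.
have e : sg_val (D - D') = sg_val D - sg_val D' by [].
congr (_, _); apply: derE => x; rewrite ?(der0_sub, der1_sub).
- by apply: (@ext_inc0_inj _ _ _ E); rewrite linearB !inc_subder0 e der0_sub.
- by apply: (@ext_inc1_inj _ _ _ E); rewrite linearB !inc_subder1 e der1_sub.
- by rewrite /der0 /= /quoder0 e der0_sub linearB.
- by rewrite /der1 /= /quoder1 e der1_sub linearB.
Qed.

Lemma restriction_is_zmod_morphism : zmod_morphism restriction.
Proof. by move=> D D'; apply: val_inj; rewrite /= der_pairB. Qed.

HB.instance Definition _ := GRing.isZmodMorphism.Build (DerV E) (Drho s)
  restriction restriction_is_zmod_morphism.

Lemma restrictionP : is_restriction_map restriction.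
Proof.
move=> D; split=> //= u; [exact: inc_subder0 | exact: inc_subder1].
Qed.

(** * Extending a compatible pair to a derivation *)

Section Extend.
Variables (ba : Der V * Der P) (h : cochain1 V P).
Hypotheses (bac : rho_compatible s ba) (ch : is_cochain1 h).
Hypothesis bah : wells_cochain ba c = coboundary s h.

Let lift_mapP : is_derivation (lift_map s ba h).
Proof.
by apply/(is_derivation_lift_map _ _ ch); split=> //; apply/wells_eqsP.
Qed.

Definition lift_der : Der hat := sg_elt (G := der_subgroup hat) lift_mapP.

Let h00 : h.1 0 = 0.
Proof.
(* The scalar -1 gives h(0) = -h(0) + h(0). *)
have := cochain1_lin0 ch (-1) 0 0.
by rewrite scaler0 add0r scaleN1r addNr.
Qed.
Let h10 : h.2 0 = 0.
Proof.
have := cochain1_lin1 ch (-1) 0 0.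
by rewrite scaler0 add0r scaleN1r addNr.
Qed.

Lemma lift_der_join0 x u :
  der0 lift_der (join0 s x u) = join0 s (der0 ba.2 x) (h.1 x + der0 ba.1 u).
Proof. exact: lift_map_join0. Qed.
Lemma lift_der_join1 a m :
  der1 lift_der (join1 s a m) = join1 s (der1 ba.2 a) (h.2 a + der1 ba.1 m).
Proof. exact: lift_map_join1. Qed.

Lemma lift_der_inc0 v : der0 lift_der (inc0 v) = inc0 (der0 ba.1 v).
Proof. by rewrite -!(join00x s) lift_der_join0 linear0 h00 add0r. Qed.
Lemma lift_der_inc1 m : der1 lift_der (inc1 m) = inc1 (der1 ba.1 m).
Proof. by rewrite -!(join10x s) lift_der_join1 linear0 h10 add0r. Qed.

Lemma preserves_sub_lift : preserves_sub lift_der.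
Proof.
split=> [v|m]; first by exists (der0 ba.1 v); apply: lift_der_inc0.
by exists (der1 ba.1 m); apply: lift_der_inc1.
Qed.

Definition lift_derV : DerV E :=
  sg_elt (G := DerV_subgroup E) preserves_sub_lift.

(** The diagonal does not see the corner [h], so Phi recovers the pair whatever [h] was used. *)
Lemma der_pair_lift : der_pair lift_derV = ba.
Proof.
rewrite [RHS]surjective_pairing.
congr (_, _); apply: derE => x.
- apply: (@ext_inc0_inj _ _ _ E); rewrite inc_subder0; exact: lift_der_inc0.
- apply: (@ext_inc1_inj _ _ _ E); rewrite inc_subder1; exact: lift_der_inc1.
- by rewrite [LHS]/(quoder0 _ _) -join0x0 lift_der_join0 proj_join0.
- by rewrite [LHS]/(quoder1 _ _) -join1x0 lift_der_join1 proj_join1.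
Qed.

End Extend.

Lemma wells_cochain0 : wells_cochain (0 : Der V * Der P) c = 0.
Proof.
rewrite -[X in wells_cochain X](subrr 0) wells_cochainB ?subrr //.
exact: is_cochain2_ext_cocycle.
Qed.

(** * The map from Z^1 *)

Section Inclusion.
Variable h : Z1 s.
Let hP : is_cocycle1 s (sg_val h) := sg_typeP h.
Let h_eq : wells_cochain 0 c = coboundary s (sg_val h).
Proof. by rewrite wells_cochain0 hP.2. Qed.

(** D_lambda is the triangular map with zero diagonal and corner lambda; its Wells condition is the
    cocycle condition 0 = coboundary lambda. *)
Definition inclusion : DerV E := lift_derV (rho_compatible0 s) hP.1 h_eq.

Lemma inclusion0 x v :
  der0 (sg_val inclusion) (join0 s x v) = inc0 ((sg_val h).1 x).
Proof.
by rewrite lift_der_join0 /= !der0_zero addr0 join00x.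
Qed.
Lemma inclusion1 a m :
  der1 (sg_val inclusion) (join1 s a m) = inc1 ((sg_val h).2 a).
Proof.
by rewrite lift_der_join1 /= !der1_zero addr0 join10x.
Qed.

End Inclusion.

Lemma der_join_ext (D D' : DerV E) :
  (forall x v,
     der0 (sg_val D) (join0 s x v) =
     der0 (sg_val D') (join0 s x v)) ->
  (forall a m,
     der1 (sg_val D) (join1 s a m) =
     der1 (sg_val D') (join1 s a m)) ->
  D = D'.
Proof.
move=> e0 e1; apply: val_inj; apply: derE => [y|b].
  by rewrite -(join0K s y).
by rewrite -(join1K s b).
Qed.

Lemma inclusion_is_zmod_morphism : zmod_morphism inclusion.
Proof.
move=> h h'; apply: der_join_ext => *.
  rewrite [sg_val (_ - _)]raddfB der0_sub !inclusion0; exact: raddfB.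
rewrite [sg_val (_ - _)]raddfB der1_sub !inclusion1; exact: raddfB.
Qed.

HB.instance Definition _ := GRing.isZmodMorphism.Build (Z1 s) (DerV E)
  inclusion inclusion_is_zmod_morphism.

Lemma inclusionP : is_inclusion_map inclusion.
Proof. by move=> h; split=> *; [exact: inclusion0 | exact: inclusion1]. Qed.

Lemma inclusion_inj : injective inclusion.
Proof.
move=> h h' e; apply: val_inj.
rewrite [LHS]surjective_pairing [RHS]surjective_pairing.
congr (_, _); apply/funext => x.
  by apply: (@ext_inc0_inj _ _ _ E); rewrite -!(inclusion0 _ x 0) e.
by apply: (@ext_inc1_inj _ _ _ E); rewrite -!(inclusion1 _ x 0) e.
Qed.

(** If Phi(D) = 0, the diagonal of D is zero, so D is D_lambda for its corner lambda, and the Wells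
    equation of D says that lambda is a cocycle. *)
Lemma exact_inclusion_restriction : exact_at inclusion restriction.
Proof.
move=> D; split=> [/(congr1 (@sg_val _ _)) e|[h <-]]; last first.
  by apply: val_inj; rewrite /= der_pair_lift.
have {}e : der_pair D = 0 by [].
have hP : is_cocycle1 s (mixder D).
  split; first exact: is_cochain1_mix.
  by have [_ /wells_eqsP <-] := der_pair_eqs D; rewrite e wells_cochain0.
exists (sg_elt (G := Z1_subgroup s) hP).
have := lift_map_der_pair D; rewrite e => eD.
apply: val_inj; apply: val_inj; rewrite /= eD.
by rewrite /der0 /der1 -surjective_pairing.
Qed.

(** * The Wells map and exactness at D_rho *)

Definition wells_cocycle (ba : Drho s) : Z2 s :=
  sg_elt (G := Z2_subgroup s)
    (is_cocycle2_wells (sg_typeP ba) (is_cocycle2_ext_cocycle s)).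

Definition wells (ba : Drho s) : H2 s := H2_class (wells_cocycle ba).

Lemma wells_is_zmod_morphism : zmod_morphism wells.
Proof.
move=> ba ba'; rewrite /wells /H2_class -raddfB; congr (sg_pi _ _).
apply: val_inj; rewrite [RHS]raddfB /= wells_cochainB //.
exact: is_cochain2_ext_cocycle.
Qed.

HB.instance Definition _ := GRing.isZmodMorphism.Build (Drho s) (H2 s)
  wells wells_is_zmod_morphism.

(** The class vanishes when the Wells cochain is the coboundary of some 1-cochain h, and such h are
    exactly the corners of derivations with the given diagonal. *)
Lemma exact_restriction_wells : exact_at restriction wells.
Proof.
move=> ba; split=> [/sg_pi_eq0 [h [ch e]]|[D <-]].
  exists (lift_derV (sg_typeP ba) ch e).
  by apply: val_inj; rewrite /= der_pair_lift.
apply/sg_pi_eq0; exists (mixder D); split; first exact: is_cochain1_mix.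
exact/wells_eqsP/(der_pair_eqs D).2.
Qed.

End WellsSequence.

Theorem theorem5p13 (F : fieldType) (V P : crossed_module F)
    (E : abelian_extension V P) (s : ext_section E) :
  exists (i : {additive Z1 s -> DerV E})
         (Phi : {additive DerV E -> Drho s})
         (W : {additive Drho s -> H2 s}),
    [/\ is_inclusion_map i, is_restriction_map Phi & is_wells_map W] /\
    [/\ injective i, exact_at i Phi & exact_at Phi W].
Proof.
exists (@inclusion _ _ _ _ s), (@restriction _ _ _ _ s), (@wells _ _ _ _ s).
split; split.
- exact: inclusionP.
- exact: restrictionP.
- by move=> ba; exists (wells_cocycle ba).
- exact: inclusion_inj.
- exact: exact_inclusion_restriction.
- exact: exact_restriction_wells.
Qed.
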